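(* S-squeezed $4$-spheres are polytopal. That is, for every integer $n>5$ and every shifted order ideal $U\subset R_{[n-6]}$ of monomials of degree at most $2$, the squeezed $4$-sphere $S_5(U)$ is isomorphic to the boundary complex of a simplicial $5$-polytope.
   Context: $R_{[m]}=K[x_1,\dots,x_m]$ is a polynomial ring over a field $K$ (only its monomials matter here; $R_{[0]}=K$), and $[n]=\{1,\dots,n\}$. For monomials $u=x_{i_1}\cdots x_{i_k}$, $v=x_{j_1}\cdots x_{j_k}$ of the same degree with $i_1\le\cdots\le i_k$, $j_1\le\cdots\le j_k$, write $u\preceq v$ if $i_p\le j_p$ for all $p$. A set $U$ of monomials of $R_{[m]}$ is a shifted order ideal of monomials if (i) $\{1,x_1,\dots,x_m\}\subset U$; (ii) $u\in U$ and $v$ divides $u$ imply $v\in U$; (iii) $u\in U$, $v\in R_{[m]}$ a monomial and $u\preceq v$ imply $v\in U$. It is ''of degree at most $k$'' if all its elements have degree at most $k$. Squeezed balls and spheres: for $n>d>0$, $m=n-d-1$ and $U\subset R_{[m]}$ a shifted order ideal of monomials of degree at most $\lfloor\frac{d+1}{2}\rfloor$, for $u=x_{i_1}\cdots x_{i_k}\in U$ with $i_1\le\cdots\le i_k$ put $$F_d(u)=\{i_1,i_1+1\}\cup\{i_2+2,i_2+3\}\cup\cdots\cup\{i_k+2(k-1),i_k+2k-1\}\cup\{n+2k-d,n+2k-d+1,\dots,n\},$$ a $(d+1)$-subset of $[n]$ (with $F_d(1)=\{n-d,\dots,n\}$). The squeezed $d$-ball $B_d(U)$ is the simplicial complex generated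 by $\{F_d(u):u\in U\}$; it is a shellable $d$-ball, and the squeezed $(d-1)$-sphere $S_d(U)$ is its boundary, i.e. the complex generated by the $d$-subsets of $[n]$ contained in exactly one facet of $B_d(U)$. If moreover $U$ has degree at most $\lfloor\frac d2\rfloor$, $S_d(U)$ is called an S-squeezed $(d-1)$-sphere. A $(d-1)$-dimensional simplicial complex is polytopal if it is isomorphic to the boundary complex of a simplicial $d$-polytope. *)

(* Defs.v *)
From mathcomp Require Import all_boot all_order all_algebra.
From mathcomp Require Import mpoly.
From mathcomp Require Import classical_sets reals.

Set Implicit Arguments.
Unset Strict Implicit.
Unset Printing Implicit Defensive.

Import Order.TTheory GRing.Theory Num.Theory.

Local Open Scope classical_set_scope.

(** A monomial of K[x_1, ..., x_m] is its exponent vector ['X_{1..m}]; the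
    coordinate [i : 'I_m] is the exponent of x_(i+1), and divisibility is the
    pointwise order [(u <= v)%MM].  The field K plays no role. *)

(** The indices i_1 <= ... <= i_k of u = x_(i_1) ... x_(i_k), counted from 1. *)
Definition mon_indices (m : nat) (u : 'X_{1..m}) : seq nat :=
  flatten [seq nseq (u i) i.+1 | i <- enum 'I_m].

Definition mon_preceq (m : nat) (u v : 'X_{1..m}) : Prop :=
  mdeg u = mdeg v /\
  forall p : nat, p < mdeg u ->
    nth 0 (mon_indices u) p <= nth 0 (mon_indices v) p.

Definition shifted_order_ideal (m : nat) (U : set 'X_{1..m}) : Prop :=
  [/\ U 0%MM /\ (forall i : 'I_m, U U_(i)%MM),
      (forall u v : 'X_{1..m}, U u -> (v <= u)%MM -> U v) &
      (forall u v : 'X_{1..m}, U u -> mon_preceq u v -> U v)].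

Definition degree_at_most (m : nat) (U : set 'X_{1..m}) (k : nat) : Prop :=
  forall u : 'X_{1..m}, U u -> mdeg u <= k.

Definition generated_complex (T : finType) (Fs : set {set T}) : set {set T} :=
  [set G | exists2 F, Fs F & G \subset F].

Definition is_facet (T : finType) (D : set {set T}) (F : {set T}) : Prop :=
  D F /\ forall G : {set T}, D G -> F \subset G -> G = F.

Definition complex_boundary (T : finType) (d : nat) (D : set {set T}) :
    set {set T} :=
  generated_complex
    [set G | #|G| = d /\ exists! F, is_facet D F /\ G \subset F].

(** The ground set {1, ..., n} is ['I_n], where [v : 'I_n] stands for the
    integer [v.+1].  The definitions are meant for 0 < d < n and
    m = n - d - 1; then no subtraction below is truncated.  As p counts from
    0, the p-th pair is {i_(p+1) + 2p, i_(p+1) + 2p + 1}. *)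

Definition squeezed_facet (n d m : nat) (u : 'X_{1..m}) : {set 'I_n} :=
  finset (fun v : 'I_n =>
    [exists p : 'I_(mdeg u),
       (v.+1 == nth 0 (mon_indices u) p + 2 * p) ||
       (v.+1 == nth 0 (mon_indices u) p + 2 * p + 1)]
    || (n + 2 * mdeg u - d <= v.+1)).

Definition squeezed_ball (n d m : nat) (U : set 'X_{1..m}) : set {set 'I_n} :=
  generated_complex [set squeezed_facet n d u | u in U].
Arguments squeezed_ball n d {m} U.

Definition squeezed_sphere (n d m : nat) (U : set 'X_{1..m}) :
    set {set 'I_n} :=
  complex_boundary d (squeezed_ball n d U).
Arguments squeezed_sphere n d {m} U.

Local Open Scope ring_scope.

Definition conv (R : realType) (d : nat) (X : set 'rV[R]_d) : set 'rV[R]_d :=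
  [set x | exists (k : nat) (p : 'I_k -> 'rV[R]_d) (w : 'I_k -> R),
    [/\ forall i, X (p i), forall i, 0 <= w i, \sum_i w i = 1 &
        x = \sum_i w i *: p i]].

Definition affinely_independent (R : realType) (d k : nat)
    (p : 'I_k -> 'rV[R]_d) : Prop :=
  forall w : 'I_k -> R,
    \sum_i w i = 0 -> \sum_i w i *: p i = 0 -> forall i, w i = 0.

Definition is_polytope (R : realType) (d : nat) (P : set 'rV[R]_d) : Prop :=
  exists s : seq 'rV[R]_d, P = conv [set` s].

Definition full_dimensional (R : realType) (d : nat) (P : set 'rV[R]_d) :
    Prop :=
  exists2 p : 'I_d.+1 -> 'rV[R]_d,
    affinely_independent p & forall i, P (p i).

(** [a = 0] is allowed, so that [set0] and [P] itself are faces of [P]. *)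
Definition is_face (R : realType) (d : nat) (P F : set 'rV[R]_d) : Prop :=
  exists (a : 'cV[R]_d) (b : R),
    (forall y, P y -> (y *m a) 0 0 <= b) /\
    F = P `&` [set x | (x *m a) 0 0 = b].

Definition is_proper_face (R : realType) (d : nat) (P F : set 'rV[R]_d) :
    Prop :=
  is_face P F /\ F <> P.

Definition is_simplex (R : realType) (d : nat) (F : set 'rV[R]_d) : Prop :=
  exists (k : nat) (p : 'I_k -> 'rV[R]_d),
    affinely_independent p /\ F = conv (range p).

Definition simplicial_polytope (R : realType) (d : nat) (P : set 'rV[R]_d) :
    Prop :=
  [/\ is_polytope P, full_dimensional P &
      forall F, is_proper_face P F -> is_simplex F].

Definition vertices (R : realType) (d : nat) (P : set 'rV[R]_d) :
    set 'rV[R]_d :=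
  [set v | is_face P [set v]].

(** A simplicial boundary is recorded by the vertex sets of its faces. *)
Definition boundary_complex (R : realType) (d : nat) (P : set 'rV[R]_d) :
    set (set 'rV[R]_d) :=
  [set vertices P `&` F | F in is_proper_face P].

(** Only the elements of [T] lying in a face of [D] are vertices of [D]. *)
Definition complex_isomorphic (T : finType) (V : Type)
    (D : set {set T}) (E : set (set V)) : Prop :=
  exists2 f : T -> V,
    {in \bigcup_(F in D) [set` F] &, injective f} &
    E = [set f @` [set` F] | F in D].

(** For a (d-1)-dimensional complex [D]. *)
Definition polytopal (R : realType) (d : nat) (T : finType)
    (D : set {set T}) : Prop :=
  exists2 P : set 'rV[R]_d,
    simplicial_polytope P & complex_isomorphic D (boundary_complex P).

(* Main.v *)
Require Import Defs.
From mathcomp Require Import all_boot all_order all_algebra.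
From mathcomp Require Import zify lra.
From mathcomp Require Import mpoly.
From mathcomp Require Import boolp classical_sets reals.
From mathcomp.boot Require Import fintype finset.

(** All facets of the ball [B_5(U)] contain the two last vertices a and b, and
    deleting these leaves the facets {i, i+1, k, k+1} of a three-dimensional
    ball T.  The sphere is therefore the boundary of the join of T with the
    edge ab: its facets are S + a and S + b for the facets S of T, and r + a + b
    for the boundary triangles r of T.

    Suppose that T is a regular triangulation of a convex region.  In
    homogeneous coordinates this means vectors x_v in R^4 and heights h_v such
    that each S is the zero set of some h - L_S >= 0 and each r that of some
    l_r >= 0, with L_S and l_r linear in x.  Put (x_v, h_v, h_v) in R^6 with
    coordinates (x, h, y), and a = (0, 0, 1), b = (0, 1, 0).  Then h - L_S
    supports S + a, y - L_S supports S + b and l_r supports r + a + b.  A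
    projective change of coordinates turns these vectors into points of R^5
    ([edge_join_polytopal]).  That the hull of the points has no further facets
    follows from closedness: every ridge of a listed facet lies in another
    listed facet, and the argument of the simplex method then shows that every
    supporting hyperplane meets the points inside a listed facet
    ([zero_set_in_facet], [pseudosphere_polytopal]).

    That T is such a regular triangulation is shown by adding one vertex at a
    time.  A new point in general position, lifted very high, extends a regular
    triangulation by the cones over the boundary facets that the point sees
    ([place_vertex]).  The pairs (i, k) of the facets of T form an up-set, and
    peeling this up-set shows that two kinds of placement suffice
    ([staircase_convex_ball]): a new first vertex that sees one triangle
    ([stack_facet]), or a new last vertex that sees all triangles at the old last
    vertex but one ([push_vertex]). *)

Set Implicit Arguments.
Unset Strict Implicit.
Unset Printing Implicit Defensive.

Import Order.TTheory GRing.Theory Num.Theory.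

(** * Linear functionals *)

Section Pairing.
Variables (R : realType) (e : nat).
Local Open Scope ring_scope.
Implicit Types (u v : 'rV[R]_e) (l m : 'cV[R]_e).

Definition pair u l : R := (u *m l) 0 0.

Lemma pair0l l : pair 0 l = 0. Proof. by rewrite /pair mul0mx mxE. Qed.
Lemma pair0r u : pair u 0 = 0. Proof. by rewrite /pair mulmx0 mxE. Qed.
Lemma pairDl u v l : pair (u + v) l = pair u l + pair v l.
Proof. by rewrite /pair mulmxDl mxE. Qed.
Lemma pairDr u l m : pair u (l + m) = pair u l + pair u m.
Proof. by rewrite /pair mulmxDr mxE. Qed.
Lemma pairNl u l : pair (- u) l = - pair u l.
Proof. by rewrite /pair mulNmx mxE. Qed.
Lemma pairNr u l : pair u (- l) = - pair u l.
Proof. by rewrite /pair mulmxN mxE. Qed.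
Lemma pairZl a u l : pair (a *: u) l = a * pair u l.
Proof. by rewrite /pair -scalemxAl mxE. Qed.
Lemma pairZr a u l : pair u (a *: l) = a * pair u l.
Proof. by rewrite /pair -scalemxAr mxE. Qed.
Lemma pair_suml (I : finType) (P : pred I) (F : I -> 'rV[R]_e) l :
  pair (\sum_(i | P i) F i) l = \sum_(i | P i) pair (F i) l.
Proof. by rewrite /pair mulmx_suml summxE. Qed.
Lemma pair_sumr (I : finType) (P : pred I) u (F : I -> 'cV[R]_e) :
  pair u (\sum_(i | P i) F i) = \sum_(i | P i) pair u (F i).
Proof. by rewrite /pair mulmx_sumr summxE. Qed.

Definition pairE :=
  (pair0l, pair0r, pairDl, pairDr, pairNl, pairNr, pairZl, pairZr).

End Pairing.

(** * Simplicial pseudospheres with supporting hyperplanes *)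

Section Supports.
Variables (R : realType) (V : finType).
Local Open Scope ring_scope.
Implicit Types (W Z : {set V}) (f : V -> R).

(** The function [f] vanishes on [Z] and is positive on the rest of [W]: it cuts
    out [Z] as a face of the points indexed by [W]. *)
Definition supports (W Z : {set V}) (f : V -> R) :=
  {in W, forall v, if v \in Z then f v = 0 else 0 < f v}.

Lemma supports_ge0 W Z f v : supports W Z f -> v \in W -> 0 <= f v.
Proof. by move=> s /s; case: ifP => _; [move-> | move/ltW]. Qed.

Lemma supports_eq0 W Z f v : supports W Z f -> v \in W -> v \in Z -> f v = 0.
Proof. by move=> s /s + vZ; rewrite vZ. Qed.

Lemma supports_gt0 W Z f v :
  supports W Z f -> v \in W -> v \notin Z -> 0 < f v.
Proof. by move=> s /s + /negbTE vZ; rewrite vZ. Qed.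

Lemma supports_sub W W' Z f : W' \subset W -> supports W Z f -> supports W' Z f.
Proof. by move=> /subsetP sub s v /sub /s. Qed.

End Supports.

Lemma set_enumeration (V : finType) (F : {set V}) d : #|F| = d ->
  exists2 s : 'I_d -> V, injective s & forall v, v \in F <-> exists i, v = s i.
Proof.
move=> <-; exists enum_val; first exact: enum_val_inj.
move=> v; split; last by case=> i ->; exact: enum_valP.
by move=> vF; exists (enum_rank_in vF v); rewrite enum_rankK_in.
Qed.

Section Pseudosphere.
Variables (R : realType) (V : finType) (d : nat).
Local Open Scope ring_scope.
Implicit Types (F G r : {set V}) (v w : V).

(** The vectors [q v] are homogeneous coordinates of points of a [d]-space, so
    that a facet has [d] elements.  The last clause, a weak form of closedness,
    is what excludes facets of the hull outside [Fs]; linear independence of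
    the facets is a consequence ([facet_free]). *)
Definition supported_pseudosphere (q : V -> 'rV[R]_d.+1)
    (l : {set V} -> 'cV[R]_d.+1) (Fs : {set {set V}}) :=
  [/\ Fs != set0, {in Fs, forall F, #|F| = d},
      {in Fs, forall F, supports (cover Fs) F (fun v => pair (q v) (l F))} &
      forall F v, F \in Fs -> v \in F ->
        exists2 F', F' \in Fs & F' != F /\ F :\ v \subset F'].

Variables (q : V -> 'rV[R]_d.+1) (l : {set V} -> 'cV[R]_d.+1).
Variable Fs : {set {set V}}.
Hypothesis sph : supported_pseudosphere q l Fs.

Let W := cover Fs.

Lemma facet_sub F : F \in Fs -> F \subset W.
Proof. by move=> FFs; apply: (bigcup_sup F). Qed.

Lemma facet_card F : F \in Fs -> #|F| = d.
Proof. by case: sph => _ + _ _; apply. Qed.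

Lemma facet_supports F :
  F \in Fs -> supports W F (fun v => pair (q v) (l F)).
Proof. by case: sph => _ _ + _; apply. Qed.

Lemma facet_neighbour F v : F \in Fs -> v \in F ->
  exists2 F', F' \in Fs & v \notin F' /\ F :\ v \subset F'.
Proof.
move=> FFs vF; have [_ _ _ /(_ F v FFs vF)[F' F'Fs [F'F sub]]] := sph.
exists F' => //; split=> //; apply: contraNN F'F => vF'.
rewrite eq_sym eqEcard !facet_card // leqnn andbT.
by rewrite -(setD1K vF) subUset sub1set vF' sub.
Qed.

(** The choice of a facet on the other side of the ridge [F :\ v]. *)
Definition neighbour F v : {set V} :=
  odflt set0 [pick F' in Fs | (v \notin F') && (F :\ v \subset F')].

Lemma neighbourP F v : F \in Fs -> v \in F ->
  [/\ neighbour F v \in Fs, v \notin neighbour F v &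
      F :\ v \subset neighbour F v].
Proof.
move=> FFs vF; rewrite /neighbour; case: pickP => [F' /and3P[]//|] /=.
by have [F' F'Fs [nv s]] := facet_neighbour FFs vF => /(_ F'); rewrite F'Fs nv s.
Qed.

Lemma pair_neighbour F v w : F \in Fs -> v \in F -> w \in F -> w != v ->
  pair (q w) (l (neighbour F v)) = 0.
Proof.
move=> FFs vF wF wv; have [nFs _ /subsetP sub] := neighbourP FFs vF.
apply: (supports_eq0 (facet_supports nFs)); last by apply: sub; rewrite !inE wv.
exact: (subsetP (facet_sub FFs)).
Qed.

Lemma pair_neighbour_gt0 F v : F \in Fs -> v \in F ->
  0 < pair (q v) (l (neighbour F v)).
Proof.
move=> FFs vF; have [nFs nv _] := neighbourP FFs vF.
apply: (supports_gt0 (facet_supports nFs)) nv.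
exact: (subsetP (facet_sub FFs)).
Qed.

(** The functional of [F] and those of its neighbours form, up to scaling, a
    dual basis: the neighbour across [F :\ v] vanishes on [F] except at [v],
    and that of [F] vanishes on [F] but not at [c]. *)
Lemma facet_free F (c : 'rV_d.+1) (a : V -> R) b : F \in Fs ->
  pair c (l F) != 0 -> \sum_(v in F) a v *: q v + b *: c = 0 ->
  b = 0 /\ {in F, forall v, a v = 0}.
Proof.
move=> FFs cF rel.
have b0 : b = 0.
  have := congr1 (fun x => pair x (l F)) rel; rewrite !pairE pair_suml big1.
    by move/eqP; rewrite add0r mulf_eq0 (negbTE cF) orbF => /eqP.
  move=> v vF; rewrite pairZl (supports_eq0 (facet_supports FFs)) ?mulr0 //.
  exact: (subsetP (facet_sub FFs)).
split=> // v vF.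
have := congr1 (fun x => pair x (l (neighbour F v))) rel.
rewrite b0 scale0r addr0 pair0l pair_suml (bigD1 v) //= big1 => [|w /andP[wF wv]].
  move/eqP; rewrite addr0 pairZl mulf_eq0 => /orP[/eqP//|].
  by rewrite gt_eqF // pair_neighbour_gt0.
by rewrite pairZl pair_neighbour // mulr0.
Qed.

Lemma facet_free_ord F (c : 'rV_d.+1) : F \in Fs -> pair c (l F) != 0 ->
  exists2 s : 'I_d -> V, (forall v, v \in F <-> exists i, v = s i) &
  forall a : 'I_d -> R, forall b, \sum_i a i *: q (s i) + b *: c = 0 ->
    b = 0 /\ forall i, a i = 0.
Proof.
move=> FFs cF; have [s s_inj sF] := set_enumeration (facet_card FFs).
exists s => // a b rel.
pose a' v := if [pick i | s i == v] is Some i then a i else 0.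
have a's i : a' (s i) = a i.
  by rewrite /a'; case: pickP => [j /eqP/s_inj->//|/(_ i)]; rewrite eqxx.
have sF' : F = [set s i | i : 'I_d].
  apply/setP => v; apply/idP/imsetP => [/sF[i ->]|[i _ ->]]; first by exists i.
  by apply/sF; exists i.
have [|b0 a0] := @facet_free F c a' b FFs cF.
- rewrite -[RHS]rel sF' big_imset /=; last by move=> i j _ _ /s_inj.
  by congr (_ + _); apply: eq_bigr => i _; rewrite a's.
- split=> // i; rewrite -a's; apply: a0; apply/sF; by exists i.
Qed.

Lemma functional_eq0 F (c : 'rV_d.+1) (m : 'cV_d.+1) : F \in Fs ->
  pair c (l F) != 0 -> {in F, forall v, pair (q v) m = 0} -> pair c m = 0 ->
  m = 0.
Proof.
move=> FFs cF mF mc; have [s sF free] := facet_free_ord FFs cF.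
(* The rows of [M] are [c] and the vectors of [F], a basis of the space. *)
pose M := \matrix_(i < d.+1)
  (if unlift ord0 i is Some j then q (s j) else c) : 'M[R]_d.+1.
have Mu : M \in unitmx.
  rewrite -row_free_unit; apply: inj_row_free => w wM.
  have rel : \sum_(i < d) w 0 (lift ord0 i) *: q (s i) + w 0 ord0 *: c = 0.
    rewrite -[RHS]wM mulmx_sum_row big_ord_recl rowK unlift_none addrC.
    by congr (_ + _); apply: eq_bigr => i _; rewrite rowK liftK.
  have [w0 wS] := free _ _ rel; apply/rowP => i; rewrite mxE.
  by case: (unliftP ord0 i) => [j ->|->].
have Mm : M *m m = 0.
  apply/colP => i; rewrite [RHS]mxE; have -> : (M *m m) i 0 = pair (row i M) m.
    by rewrite /pair -row_mul [RHS]mxE.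
  rewrite rowK; case: (unlift _ _) => [j|//]; apply: mF; apply/sF; by exists j.
by rewrite -(mulKmx Mu m) Mm mulmx0.
Qed.

Lemma exists_outside F v : v \in W -> F \in Fs -> exists2 w, w \in W & w \notin F.
Proof.
move=> vW FFs; have [vF|] := boolP (v \in F); last by exists v.
have [nFs vn _] := neighbourP FFs vF.
have /subsetPn[w wn wF] : ~~ (neighbour F v \subset F).
  apply: contraNN vn => sub; suff -> : neighbour F v = F by [].
  by apply/eqP; rewrite eqEcard sub !facet_card ?leqnn.
by exists w => //; apply: (subsetP (facet_sub nFs)).
Qed.

(** The simplex method.  Let [z] be the sum of the points where [m] vanishes and
    choose a facet [F] whose functional, normalized at an interior vector [c],
    is minimal at [z].  Comparing with the neighbours of [F] shows that [m] is a
    positive multiple of the functional of [F] plus a nonnegative combination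
    of functionals that are nonnegative at [z].  Hence the functional of [F]
    vanishes at [z], that is, at every point where [m] does. *)
Lemma zero_set_in_facet (m : 'cV_d.+1) :
  {in W, forall v, 0 <= pair (q v) m} ->
  (exists2 v, v \in W & pair (q v) m != 0) ->
  exists2 F, F \in Fs & {in W, forall v, pair (q v) m = 0 -> v \in F}.
Proof.
move=> m_ge0 [v0 v0W mv0].
pose c : 'rV_d.+1 := \sum_(v in W) q v.
have c_gt0 F : F \in Fs -> 0 < pair c (l F).
  move=> FFs; have [w wW wF] := exists_outside v0W FFs.
  rewrite pair_suml (bigD1 w) //= ltr_wpDr //.
    apply: sumr_ge0 => v /andP[vW _].
    exact: (supports_ge0 (facet_supports FFs)).
  exact: (supports_gt0 (facet_supports FFs)).
have cm_gt0 : 0 < pair c m.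
  rewrite pair_suml (bigD1 v0) //= ltr_wpDr //.
    by apply: sumr_ge0 => v /andP[vW _]; apply: m_ge0.
  by rewrite lt0r mv0 m_ge0.
pose z : 'rV_d.+1 := \sum_(v in W | pair (q v) m == 0) q v.
have zm : pair z m = 0 by rewrite pair_suml big1 // => v /andP[_ /eqP].
have /set0Pn[F0 F0Fs] : Fs != set0 by case: sph.
case: (arg_minP (fun F => pair z (l F) / pair c (l F)) F0Fs) => F FFs Fmin.
(* The direction of the edge of the dual cone from [F] to its neighbour. *)
pose e v := pair c (l F) *: l (neighbour F v) - pair c (l (neighbour F v)) *: l F.
have FW v : v \in F -> v \in W by apply/subsetP/facet_sub.
have lF0 v : v \in F -> pair (q v) (l F) = 0.
  by move=> vF; apply: (supports_eq0 (facet_supports FFs)) => //; apply: FW.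
have e0 v w : v \in F -> w \in F -> w != v -> pair (q w) (e v) = 0.
  by move=> vF wF wv; rewrite !pairE (pair_neighbour FFs) // lF0 // !mulr0 subr0.
have e_gt0 v : v \in F -> 0 < pair (q v) (e v).
  move=> vF; rewrite !pairE lF0 // mulr0 subr0 mulr_gt0 ?c_gt0 //.
  exact: pair_neighbour_gt0.
have ec v : pair c (e v) = 0 by rewrite !pairE mulrC subrr.
have ez v : v \in F -> 0 <= pair z (e v).
  move=> vF; have [nFs _ _] := neighbourP FFs vF.
  have := Fmin _ nFs; rewrite ler_pdivlMr ?c_gt0 //.
  rewrite mulrAC ler_pdivrMr ?c_gt0 // !pairE subr_ge0.
  by rewrite mulrC [X in _ <= X]mulrC.
pose a v := pair (q v) m / pair (q v) (e v).
pose b := pair c m / pair c (l F).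
have mE : m = \sum_(v in F) a v *: e v + b *: l F.
  apply/eqP; rewrite -subr_eq0; apply/eqP.
  apply: (@functional_eq0 F c) => //; first by rewrite gt_eqF ?c_gt0.
    move=> v vF; rewrite !pairE lF0 // pair_sumr (bigD1 v) //= big1.
      by rewrite pairZr /a mulfVK ?gt_eqF ?e_gt0 // mulr0 !addr0 subrr.
    by move=> w /andP[wF wv]; rewrite pairZr e0 ?mulr0 // eq_sym.
  rewrite !pairE pair_sumr big1 => [|v vF]; last by rewrite pairZr ec mulr0.
  by rewrite /b mulfVK ?gt_eqF ?c_gt0 // add0r subrr.
have lz_ge0 : 0 <= pair z (l F).
  rewrite pair_suml; apply: sumr_ge0 => v /andP[vW _].
  exact: (supports_ge0 (facet_supports FFs)).
have lz : pair z (l F) = 0.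
  apply/eqP; rewrite eq_le lz_ge0 andbT.
  have b_gt0 : 0 < b by rewrite divr_gt0 ?c_gt0.
  rewrite -(pmulr_rle0 _ b_gt0) -zm mE !pairE lerDr pair_sumr.
  apply: sumr_ge0 => v vF; rewrite pairZr mulr_ge0 ?ez // /a divr_ge0 //.
    exact/m_ge0/FW.
  exact/ltW/e_gt0.
exists F => // v vW mv; apply: contraTT isT => vF.
have := lz; rewrite pair_suml (bigD1 v) /= ?vW ?mv ?eqxx // => /eqP.
rewrite gt_eqF // ltr_wpDr //; last exact: (supports_gt0 (facet_supports FFs)).
apply: sumr_ge0 => w /andP[/andP[wW _] _].
exact: (supports_ge0 (facet_supports FFs)).
Qed.

(** The functionals vanishing on a ridge form a plane, in which those of [F1]
    and [F2] are a basis.  At the points of [F1] and [F2] off the ridge, that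
    of [F3] is positive, so it is a positive combination of the two; but then it
    is positive on [F3] off the ridge. *)
Lemma ridge_in_two_facets r F1 F2 F3 : #|r|.+1 = d ->
  F1 \in Fs -> F2 \in Fs -> F3 \in Fs ->
  r \subset F1 -> r \subset F2 -> r \subset F3 ->
  F1 != F2 -> F2 != F3 -> F3 != F1 -> False.
Proof.
move=> rd F1s F2s F3s r1 r2 r3 n12 n23 n31.
have split F : F \in Fs -> r \subset F -> exists v, v \in F /\ F = v |: r.
  move=> FFs rF.
  have : #|F :\: r| == 1%N.
    by rewrite cardsD (setIidPr rF) facet_card // -rd subSnn.
  case/cards1P => v Fv; have /setDP[vF _] : v \in F :\: r by rewrite Fv set11.
  exists v; split=> //; rewrite -Fv; apply/setP => w; rewrite !inE.
  by have [/(subsetP rF)->|] := boolP (w \in r); rewrite ?orbF.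
have [[v1 [v1F E1]] [v2 [v2F E2]] [v3 [v3F E3]]] :=
  And3 (split _ F1s r1) (split _ F2s r2) (split _ F3s r3).
have pos F F' v : F \in Fs -> F' \in Fs -> r \subset F' -> v \in F ->
    F = v |: r -> F != F' -> 0 < pair (q v) (l F').
  move=> Fs1 Fs1' rF' vF FE nF; apply: (supports_gt0 (facet_supports Fs1')).
    exact: (subsetP (facet_sub Fs1)).
  apply: contraNN nF => vF'; rewrite eqEcard !facet_card // leqnn andbT.
  by rewrite FE subUset sub1set vF'.
have zero F v : F \in Fs -> v \in F -> pair (q v) (l F) = 0.
  move=> Fs1 vF; apply: (supports_eq0 (facet_supports Fs1)) => //.
  exact: (subsetP (facet_sub Fs1)).
have [p12 p13] : 0 < pair (q v1) (l F2) /\ 0 < pair (q v1) (l F3).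
  by split; [apply: (pos F1) | apply: (pos F1); rewrite 1?eq_sym].
have [p21 p23] : 0 < pair (q v2) (l F1) /\ 0 < pair (q v2) (l F3).
  by split; [apply: (pos F2); rewrite 1?eq_sym | apply: (pos F2)].
have [p31 p32] : 0 < pair (q v3) (l F1) /\ 0 < pair (q v3) (l F2).
  by split; [apply: (pos F3) | apply: (pos F3); rewrite 1?eq_sym].
pose a := pair (q v2) (l F3) / pair (q v2) (l F1).
pose b := pair (q v1) (l F3) / pair (q v1) (l F2).
have [a0 b0] : 0 < a /\ 0 < b by rewrite !divr_gt0.
have m0 : l F3 - (a *: l F1 + b *: l F2) = 0.
  apply: (@functional_eq0 F1 (q v2)) => //; first by rewrite gt_eqF.
    move=> v; rewrite {1}E1 => /setU1P[->|vr].
      by rewrite !pairE (zero F1) // /b mulr0 add0r mulfVK ?gt_eqF // subrr.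
    by rewrite !pairE !zero ?(subsetP r1, subsetP r2, subsetP r3) // !mulr0 addr0 subrr.
  by rewrite !pairE (zero F2) // /a mulfVK ?gt_eqF // mulr0 addr0 subrr.
have := congr1 (pair (q v3)) m0; rewrite !pairE zero // sub0r => /eqP.
by rewrite oppr_eq0 gt_eqF // addr_gt0 // mulr_gt0.
Qed.

(** Adding the neighbours across [F :\ w] for all [w] outside [G] shrinks the
    zero set from [F] to [G]. *)
Definition face_functional F G : 'cV_d.+1 :=
  l F + \sum_(w in F :\: G) l (neighbour F w).

Lemma supports_face F G : F \in Fs -> G \subset F ->
  supports W G (fun v => pair (q v) (face_functional F G)).
Proof.
move=> FFs /subsetP GF v vW; rewrite /face_functional pairDr pair_sumr.
have nge w : w \in F :\: G -> 0 <= pair (q v) (l (neighbour F w)).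
  rewrite inE => /andP[_ wF]; have [nFs _ _] := neighbourP FFs wF.
  exact: (supports_ge0 (facet_supports nFs)).
case: ifP => [vG|/negbT vG].
  rewrite (supports_eq0 (facet_supports FFs)) ?GF // add0r big1 // => w.
  rewrite inE => /andP[wG wF]; apply: pair_neighbour => //; first exact: GF.
  by apply: contraNneq wG => <-.
have [vF|vF] := boolP (v \in F).
  apply: ltr_wpDl; first exact: (supports_ge0 (facet_supports FFs)).
  rewrite (bigD1 v) ?inE ?vG //= ltr_wpDr ?pair_neighbour_gt0 //.
  by apply: sumr_ge0 => w /andP[/nge].
apply: ltr_wpDr; first by apply: sumr_ge0.
exact: (supports_gt0 (facet_supports FFs)).
Qed.

End Pseudosphere.

(** * From pseudospheres to boundary complexes of polytopes *)

Section Homogeneous.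
Variables (R : realType) (d : nat).
Local Open Scope ring_scope.

(** A point of the affine space as a vector with first coordinate 1. *)
Definition homvec (u : 'rV[R]_d) : 'rV[R]_d.+1 := row_mx (1%:M : 'rV_1) u.

Lemma pair_homvec u (m : 'cV[R]_d.+1) :
  pair (homvec u) m = (usubmx (m : 'cV_(1 + d))) 0 0 + pair u (dsubmx (m : 'cV_(1 + d))).
Proof.
rewrite /pair /homvec -[X in _ *m X](@vsubmxK _ 1 d 1 m) (@mul_row_col _ 1 1 d 1).
by rewrite mul1mx mxE.
Qed.

Definition affine_functional (b : R) (a : 'cV[R]_d) : 'cV[R]_d.+1 :=
  col_mx (b%:M : 'cV_1) a.

Lemma pair_affine u b a : pair (homvec u) (affine_functional b a) = b + pair u a.
Proof.
by rewrite pair_homvec /affine_functional (@col_mxKu _ 1) (@col_mxKd _ 1) mxE.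
Qed.

Lemma homvec_sum (I : finType) (P : pred I) (w : I -> R) (u : I -> 'rV[R]_d) :
  \sum_(i | P i) w i *: homvec (u i) =
  row_mx ((\sum_(i | P i) w i)%:M : 'rV_1) (\sum_(i | P i) w i *: u i).
Proof.
rewrite -[LHS](@hsubmxK _ 1 1 d); apply: (f_equal2 (@row_mx R 1 1 d)).
  apply/rowP => j; rewrite !ord1 !mxE !summxE mulr1n; apply: eq_bigr => i _.
  by rewrite mxE /homvec (@row_mxEl _ 1 1 d) mxE mulr1.
apply/rowP => j; rewrite mxE !summxE; apply: eq_bigr => i _.
by rewrite mxE /homvec (@row_mxEr _ 1 1 d) mxE.
Qed.

End Homogeneous.

Section Polytope.
Variables (R : realType) (V : finType) (d : nat) (p : V -> 'rV[R]_d).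
Local Open Scope ring_scope.
Implicit Types (F G r : {set V}) (v w : V).

Definition hull G : classical_sets.set 'rV[R]_d := conv (p @` [set` G])%classic.

Lemma hullP G y : hull G y <->
  exists w : V -> R, [/\ {in G, forall v, 0 <= w v}, \sum_(v in G) w v = 1 &
    y = \sum_(v in G) w v *: p v].
Proof.
split.
- case=> k [u [w [uG w_ge0 w1 ->]]].
  have /choice[s sP] : forall i, exists v, v \in G /\ p v = u i.
    by move=> i; have [v vG <-] := uG i; exists v.
  exists (fun v => \sum_(i | s i == v) w i); split.
  + by move=> v _; apply: sumr_ge0.
  + rewrite -[RHS]w1 [RHS](partition_big s (fun v => v \in G)) //= => i _.
    exact: (sP i).1.
  rewrite (partition_big s (fun v => v \in G)) /= => [|i _]; last exact: (sP i).1.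
  apply: eq_bigr => v _; rewrite scaler_suml; apply: eq_bigr => i /eqP <-.
  by rewrite (sP i).2.
case=> w [w_ge0 w1 ->].
exists #|G|, (fun i => p (enum_val i)), (fun i => w (enum_val i)); split.
- by move=> i; exists (enum_val i) => //=; apply: enum_valP.
- by move=> i; apply/w_ge0/enum_valP.
- by rewrite -[RHS]w1 [RHS]big_enum_val.
- by rewrite big_enum_val.
Qed.

Lemma hull_vertex G v : v \in G -> hull G (p v).
Proof.
move=> vG; apply/hullP; exists (fun w => (w == v)%:R); split.
- by move=> w _; rewrite ler0n.
- by rewrite (bigD1 v) //= eqxx big1 ?addr0 // => w /andP[_ /negbTE->].
- rewrite (bigD1 v) //= eqxx scale1r big1 ?addr0 // => w /andP[_ /negbTE->].
  by rewrite scale0r.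
Qed.

Lemma hull_subset G F : G \subset F -> (hull G `<=` hull F)%classic.
Proof.
move=> /subsetP sub y [k [u [w [uG w_ge0 w1 yE]]]]; exists k, u, w; split=> //.
by move=> i; have [v vG <-] := uG i; exists v => //; apply: sub.
Qed.

Lemma hull1 v : hull [set v] = [set p v]%classic.
Proof.
apply/seteqP; split=> [y /hullP[w [_ + ->]]|_ ->]; last first.
  by apply: hull_vertex; rewrite inE.
by rewrite !big_set1 => ->; rewrite scale1r.
Qed.

Lemma pair_hull (m : 'cV_d.+1) G (w : V -> R) : \sum_(v in G) w v = 1 ->
  pair (homvec (\sum_(v in G) w v *: p v)) m =
  \sum_(v in G) w v * pair (homvec (p v)) m.
Proof.
move=> w1; rewrite {1}/homvec -w1 -homvec_sum pair_suml.
by apply: eq_bigr => v _; rewrite pairZl.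
Qed.

(** A convex combination where a functional nonnegative on the points vanishes
    has weights only on points where it vanishes. *)
Lemma hull_zero_set (m : 'cV_d.+1) F :
  {in F, forall v, 0 <= pair (homvec (p v)) m} ->
  (hull F `&` [set y | pair (homvec y) m = 0])%classic =
  hull [set v in F | pair (homvec (p v)) m == 0].
Proof.
move=> m_ge0; apply/seteqP; split=> [_ [/hullP[w [w_ge0 w1 ->]] /=]|y].
  rewrite pair_hull // => /psumr_eq0P-/(_ _)/wrap[] => [v vF|z].
    by rewrite mulr_ge0 ?w_ge0 ?m_ge0.
  have w0 v : v \in F -> v \notin [set v in F | pair (homvec (p v)) m == 0] ->
      w v = 0.
    move=> vF; rewrite inE vF /= => nz; move/eqP: (z v vF).
    by rewrite mulf_eq0 (negbTE nz) orbF => /eqP.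
  have restr (M : lmodType R) (u : V -> M) :
      \sum_(v in F) w v *: u v =
      \sum_(v in [set v in F | pair (homvec (p v)) m == 0]) w v *: u v.
    rewrite (bigID (mem [set v in F | pair (homvec (p v)) m == 0])) /=.
    rewrite [X in _ + X]big1 ?addr0 => [|v /andP[vF nv]]; last first.
      by rewrite w0 ?scale0r.
    by apply: eq_bigl => v; rewrite inE andbA andbb.
  apply/hullP; exists w; split.
  - by move=> v; rewrite inE => /andP[/w_ge0].
  - have := restr R^o (fun=> 1); rewrite -!scaler_suml w1 => E.
    by apply/esym; move: E; rewrite /GRing.scale /= !mulr1.
  - exact: restr.
move=> yZ; split; first by apply: hull_subset yZ; apply/subsetP=> v /[!inE]/andP[].
move/hullP: yZ => [w [_ w1 ->]] /=; rewrite pair_hull // big1 // => v.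
by rewrite inE => /andP[_ /eqP->]; rewrite mulr0.
Qed.

Lemma is_face_hull F (G : classical_sets.set 'rV[R]_d) : is_face (hull F) G <->
  exists2 m : 'cV_d.+1, {in F, forall v, 0 <= pair (homvec (p v)) m} &
    G = hull [set v in F | pair (homvec (p v)) m == 0].
Proof.
split=> [[a [b [le_b ->]]]|[m m_ge0 ->]].
  have E y : pair (homvec y) (affine_functional b (- a)) = b - (y *m a) 0 0.
    by rewrite pair_affine pairNr.
  exists (affine_functional b (- a)).
    by move=> v vF; rewrite E subr_ge0; apply/le_b/hull_vertex.
  rewrite -hull_zero_set => [|v vF]; last first.
    by rewrite E subr_ge0; apply/le_b/hull_vertex.
  congr (_ `&` _)%classic; apply/seteqP; split=> y /=; rewrite E.
    by move=> ->; rewrite subrr.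
  by move/eqP; rewrite subr_eq0 => /eqP.
exists (- dsubmx (m : 'cV_(1 + d))), (usubmx (m : 'cV_(1 + d)) 0 0).
have E y : pair (homvec y) m = usubmx (m : 'cV_(1 + d)) 0 0 -
    (y *m (- dsubmx (m : 'cV_(1 + d)))) 0 0.
  by rewrite pair_homvec mulmxN [(- _ : 'M_1) 0 0]mxE opprK.
split=> [y /hullP[w [w_ge0 w1 ->]]|].
  rewrite -subr_ge0 -E pair_hull //; apply: sumr_ge0 => v vF.
  by rewrite mulr_ge0 ?w_ge0 ?m_ge0.
rewrite -hull_zero_set //; congr (_ `&` _)%classic.
apply/seteqP; split=> y /=; rewrite E.
  by move/eqP; rewrite subr_eq0 => /eqP.
by move=> ->; rewrite subrr.
Qed.

Variables (l : {set V} -> 'cV[R]_d.+1) (Fs : {set {set V}}).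
Hypothesis sph : supported_pseudosphere (fun v => homvec (p v)) l Fs.
Hypothesis d_gt0 : (0 < d)%N.

Let W := cover Fs.

Lemma facet_outside F : F \in Fs -> exists2 w, w \in W & w \notin F.
Proof.
move=> FFs; have : F != set0 by rewrite -card_gt0 (facet_card sph).
case/set0Pn => v vF; apply: (exists_outside sph (v := v)) => //.
exact: (subsetP (facet_sub FFs)).
Qed.

Lemma face_of_subset F G : F \in Fs -> G \subset F ->
  is_proper_face (hull W) (hull G).
Proof.
move=> FFs GF; have s := supports_face sph FFs GF.
set m := face_functional _ _ _ _ in s.
have GZ : [set v in W | pair (homvec (p v)) m == 0] = G.
  apply/setP => v; rewrite inE; have [vW|vW] /= := boolP (v \in W); last first.
    apply/esym/negbTE; apply: contraNN vW => vG.
    exact: (subsetP (facet_sub FFs)) (subsetP GF _ vG).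
  by have := s v vW; case: ifP => [_ ->|_ /gt_eqF->]; rewrite ?eqxx.
split.
  apply/is_face_hull; exists m; last by rewrite GZ.
  by move=> v vW; apply: (supports_ge0 s).
have [w wW wF] := facet_outside FFs => E.
have : hull G (p w) by rewrite E; apply: hull_vertex.
rewrite -GZ -hull_zero_set => [[_ /= /eqP]|v vW]; last exact: (supports_ge0 s).
rewrite gt_eqF //; apply: (supports_gt0 s) => //.
by apply: contraNN wF; apply/subsetP.
Qed.

Lemma proper_face_subset (G : classical_sets.set 'rV[R]_d) :
  is_proper_face (hull W) G ->
  exists F H : {set V}, [/\ F \in Fs, H \subset F & G = hull H].
Proof.
case=> /is_face_hull[m m_ge0 ->] proper.
have [|F FFs zF] := zero_set_in_facet sph m_ge0.
  apply: contrapT => allz; apply: proper; congr hull; apply/setP => v.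
  rewrite inE; have [vW|//] := boolP (v \in W); apply/eqP.
  by apply: contrapT => /eqP nz; apply: allz; exists v.
exists F, [set v in W | pair (homvec (p v)) m == 0]; split=> //.
by apply/subsetP => v; rewrite inE => /andP[vW /eqP]; apply: zF.
Qed.

Lemma point_inj : {in W &, injective p}.
Proof.
move=> v w vW wW pvw; apply/eqP; apply: contraT => nvw.
have /bigcupP[F FFs vF] := vW.
have vF1 : [set v] \subset F by rewrite sub1set.
have s := supports_face sph FFs vF1.
have wv : w \notin [set v] by rewrite inE eq_sym.
have := supports_gt0 s wW wv.
by rewrite -pvw (supports_eq0 s vW) ?ltxx // inE.
Qed.

Lemma vertices_hull : vertices (hull W) = (p @` [set` W])%classic.
Proof.
apply/seteqP; split=> [y|_ [v vW <-]].
  case/is_face_hull => m _ E; set Z := [set v in W | _] in E.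
  have : hull Z y by rewrite -E.
  have [->|[v vZ] _] := set_0Vmem Z.
    move/hullP => [w [_ + _]]; rewrite big_set0 => /eqP.
    by rewrite eq_sym oner_eq0.
  have : hull Z (p v) by apply: hull_vertex.
  by rewrite -E => /= <-; exists v => //; move: vZ; rewrite inE => /andP[].
have /bigcupP[F FFs vF] : v \in W by [].
by rewrite /vertices /= -hull1; apply: (face_of_subset FFs _).1; rewrite sub1set.
Qed.

Lemma hull_is_simplex F G : F \in Fs -> G \subset F -> is_simplex (hull G).
Proof.
move=> FFs GF; exists #|G|, (fun i => p (enum_val i)); split.
  move=> w w0 wp.
  have [z zW zF] := facet_outside FFs.
  have zl : pair (homvec (p z)) (l F) != 0.
    by rewrite gt_eqF // (supports_gt0 (facet_supports sph FFs)).
  pose a v := if [pick i | enum_val i == v :> V] is Some i then w i else 0.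
  have aE i : a (enum_val i) = w i.
    rewrite /a; case: pickP => [j /eqP/enum_val_inj->//|/(_ i)].
    by rewrite eqxx.
  have a0 v : v \notin G -> a v = 0.
    rewrite /a; case: pickP => // i /eqP <-; by rewrite enum_valP.
  have rel : \sum_(v in F) a v *: homvec (p v) + 0 *: homvec (p z) = 0.
    rewrite scale0r addr0 (bigID (mem G)) /= [X in _ + X]big1 ?addr0; last first.
      by move=> v /andP[_ /a0->]; rewrite scale0r.
    rewrite (eq_bigl (mem G)) => [|v]; last first.
      by rewrite andb_idl //; apply/subsetP.
    rewrite big_enum_val (eq_bigr (fun i => w i *: homvec (p (enum_val i)))).
      by rewrite homvec_sum w0 wp -scalemx1 scale0r row_mx0.
    by move=> i _; rewrite aE.
  have [_ aF] := facet_free sph FFs zl rel.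
  by move=> i; rewrite -aE aF // (subsetP GF) // enum_valP.
congr conv; apply/seteqP; split=> [_ [v vG <-]|_ [i _ <-]].
  by exists (enum_rank_in vG v) => //; rewrite enum_rankK_in.
by exists (enum_val i) => //=; apply: enum_valP.
Qed.

Lemma hull_full_dimensional : full_dimensional (hull W).
Proof.
have /set0Pn[F FFs] : Fs != set0 by case: sph.
have [z zW zF] := facet_outside FFs.
have zl : pair (homvec (p z)) (l F) != 0.
  by rewrite gt_eqF // (supports_gt0 (facet_supports sph FFs)).
have [s sF free] := facet_free_ord sph FFs zl.
pose u (i : 'I_d.+1) := if unlift ord0 i is Some j then p (s j) else p z.
exists u.
  move=> w w0 wu.
  have rel : \sum_(i < d) w (lift ord0 i) *: homvec (p (s i))
             + w ord0 *: homvec (p z) = 0.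
    have := homvec_sum predT w u; rewrite w0 wu -scalemx1 scale0r row_mx0.
    rewrite big_ord_recl {1}/u unlift_none addrC => E; rewrite -[RHS]E.
    by congr (_ + _); apply: eq_bigr => i _; rewrite /u liftK.
  have [wz ws] := free _ _ rel.
  by move=> i; case: (unliftP ord0 i) => [j ->|->].
move=> i; rewrite /u; case: (unlift _ _) => [j|]; apply: hull_vertex => //.
by apply: (subsetP (facet_sub FFs)); apply/sF; exists j.
Qed.

Theorem pseudosphere_polytopal :
  polytopal R d (generated_complex [set` Fs]%classic).
Proof.
exists (hull W).
  split; last 2 first.
  - exact: hull_full_dimensional.
  - by move=> G /proper_face_subset[F [H [FFs HF ->]]]; apply: hull_is_simplex HF.
  exists [seq p v | v <- enum W]; congr conv.
  apply/seteqP; split=> [_ [v vW <-]|y /= /mapP[v]].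
    by apply/mapP; exists v => //; rewrite mem_enum.
  by rewrite mem_enum => vW ->; exists v.
exists p.
  have sub v : v \in (\bigcup_(F in generated_complex [set` Fs]) [set` F])%classic ->
      v \in W.
    rewrite in_setE => -[G [F FFs GF] vG].
    by apply: (subsetP (facet_sub FFs)); apply: (subsetP GF).
  by move=> v w /sub vW /sub wW; apply: point_inj.
have vertexI F G : F \in Fs -> G \subset F ->
    (vertices (hull W) `&` hull G = p @` [set` G])%classic.
  move=> FFs GF; rewrite vertices_hull; apply/seteqP; split=> [_ [[v vW <-]]|].
    have s := supports_face sph FFs GF => vG; exists v => //=.
    apply: contraT => nvG; move: vG => /hullP[w [_ w1 E]].
    have := supports_gt0 s vW nvG; rewrite E pair_hull // big1 ?ltxx // => u uG.
    rewrite (supports_eq0 s) ?mulr0 //.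
    exact: (subsetP (facet_sub FFs)) (subsetP GF _ uG).
  move=> _ [v vG <-]; split; last exact: hull_vertex.
  by exists v => //=; apply: (subsetP (facet_sub FFs)); apply: (subsetP GF).
apply/seteqP; split=> [_ [G /proper_face_subset[F [H [FFs HF ->]]] <-]|].
  by exists H; [exists F | rewrite (vertexI F)].
move=> _ [G [F FFs GF] <-]; exists (hull G); first exact: (face_of_subset FFs).
exact: vertexI FFs GF.
Qed.

End Polytope.

(** * Regular triangulations with convex support *)

Lemma odd_sum (I : finType) (P : pred I) (F : I -> nat) :
  odd (\sum_(i | P i) F i) = odd #|[set i | P i && odd (F i)]|.
Proof.
rewrite -sum1dep_card big_mkcondr /=.
elim/big_rec2: _ => // i m k _; rewrite !oddD => ->.
by case: (odd (F i)).
Qed.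

Section Boundary.
Variables (V : finType) (D : nat).
Implicit Types (B Vis : {set {set V}}) (S r s e : {set V}) (p q v z : V).

Definition degree B r := #|[set S in B | r \subset S]|.

(** Ridges are counted modulo 2.  For a pseudomanifold these are the ridges in
    exactly one facet; with parity the boundary is closed without any
    assumption on [B] ([even_boundary_star]). *)
Definition boundary B : {set {set V}} :=
  [set r : {set V} | (#|r|.+1 == D) && odd (degree B r)].

Lemma boundary_card B r : r \in boundary B -> #|r|.+1 = D.
Proof. by rewrite inE => /andP[/eqP]. Qed.

Lemma boundary_facet B r : r \in boundary B -> exists2 S, S \in B & r \subset S.
Proof.
rewrite inE => /andP[_ /odd_gt0]; rewrite /degree card_gt0 => /set0Pn[S].
by rewrite inE => /andP[SB rS]; exists S.
Qed.

Lemma boundary_cover B r : r \in boundary B -> r \subset cover B.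
Proof.
by case/boundary_facet => S SB rS; apply: subset_trans rS _; apply: bigcup_sup.
Qed.

Lemma boundary_eq B r s : r \in boundary B -> s \in boundary B -> r \subset s ->
  r = s.
Proof.
move=> /boundary_card rD /boundary_card sD rs; apply/eqP.
by rewrite eqEcard rs -ltnS rD sD leqnn.
Qed.

(** The boundary has no boundary: a facet containing the codimension-two set [e]
    has two ridges containing [e]. *)
Lemma even_boundary_star B e : {in B, forall S, #|S| = D} -> #|e|.+2 = D ->
  ~~ odd #|[set q | (q \notin e) && (q |: e \in boundary B)]|.
Proof.
move=> BD eD.
have even_sum : ~~ odd (\sum_(q | q \notin e) degree B (q |: e)).
  under eq_bigr => q _ do
    rewrite /degree -sum1_card (eq_bigl _ _ (in_set _)) big_mkcondr /=.
  rewrite exchange_big /= big_mkcond /=.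
  elim/big_rec: _ => // S n _ IH; case: ifP => // SB; rewrite oddD (negbTE IH).
  rewrite addbF -big_mkcondr sum1dep_card.
  have [eS|neS] := boolP (e \subset S); last first.
    rewrite (_ : [set _ | _] = set0) ?cards0 //; apply/setP => q.
    by rewrite !inE subUset (negbTE neS) !andbF.
  rewrite (_ : [set _ | _] = S :\: e).
    by rewrite cardsD (setIidPr eS) BD // -eD -addn2 addKn.
  by apply/setP => q; rewrite !inE subUset sub1set eS andbT.
rewrite odd_sum in even_sum; rewrite (_ : [set q | _] =
  [set q | (q \notin e) && odd (degree B (q |: e))]) //.
apply/setP => q; rewrite !inE; case: (boolP (q \in e)) => //= qe.
by rewrite cardsU1 qe add1n eD eqxx.
Qed.

Section AddVertex.
Variables (B Vis : {set {set V}}) (z : V).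
Hypotheses (BD : {in B, forall S, #|S| = D}) (zB : z \notin cover B).
Hypothesis VisB : Vis \subset boundary B.

(** [Vis] stands for the boundary ridges that the new vertex sees. *)
Definition add_vertex : {set {set V}} := B :|: [set z |: r | r in Vis].

Lemma notin_facet S : S \in B -> z \notin S.
Proof. by move=> SB; apply: contraNN zB; apply/subsetP/bigcup_sup. Qed.

Lemma notin_visible r : r \in Vis -> z \notin r.
Proof.
by move=> /(subsetP VisB)/boundary_cover rB; apply: contraNN zB; apply/subsetP.
Qed.

Lemma add_vertex_card : {in add_vertex, forall S, #|S| = D}.
Proof.
move=> S /setUP[/BD//|/imsetP[r rV ->]].
by rewrite cardsU1 notin_visible // add1n (boundary_card (subsetP VisB _ rV)).
Qed.

Lemma cover_add_vertex : cover add_vertex \subset z |: cover B.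
Proof.
apply/bigcupsP => S /setUP[SB|/imsetP[r /(subsetP VisB)/boundary_cover rB ->]].
  by apply: subset_trans (subsetUr _ _); apply: bigcup_sup.
exact: setUS.
Qed.

(** A visible ridge gets one more facet, so it leaves the boundary. *)
Lemma boundary_add_vertex_old r : r \in boundary add_vertex -> z \notin r ->
  r \in boundary B :\: Vis.
Proof.
move=> /[dup] /boundary_card rD; rewrite inE rD eqxx /= => odd_r zr.
have subV s : s \in Vis -> (r \subset z |: s) = (r == s).
  move=> sV; apply/idP/eqP => [rs|->]; last exact: subsetUr.
  apply/eqP; rewrite eqEcard -ltnS rD.
  rewrite -(boundary_card (subsetP VisB _ sV)) leqnn andbT.
  apply/subsetP => v vr; have /setU1P[vz|//] := subsetP rs _ vr.
  by rewrite -vz vr in zr.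
have degE : degree add_vertex r = degree B r + (r \in Vis).
  have -> : degree add_vertex r =
      #|[set S in B | r \subset S] :|: (if r \in Vis then [set z |: r] else set0)|.
    congr #|pred_of_set _|; apply/setP => S; rewrite !inE andb_orl; congr (_ || _).
    apply/andP/idP => [[/imsetP[s sV ->]]|].
      by rewrite subV // => /eqP->; rewrite sV inE.
    case: ifP => [rV|]; rewrite inE // => /eqP ->; split; last exact: subsetUr.
    exact: imset_f.
  rewrite cardsU; case: ifP => [rV|_]; last by rewrite setI0 !cards0 subn0.
  rewrite cards1 (_ : _ :&: _ = set0) ?cards0 ?subn0 //.
  apply/setP => S; rewrite !inE; apply: contraTF isT => /andP[/andP[SB _] /eqP SE].
  by have := notin_facet SB; rewrite SE setU11.
move: odd_r; rewrite degE oddD inE; have [rV|rV] /= := boolP (r \in Vis).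
  have : r \in boundary B by apply: (subsetP VisB).
  by rewrite inE => /andP[_ ->].
by rewrite addbF inE rD eqxx => ->.
Qed.

(** Without [z], a new boundary ridge lies in an odd number of visible boundary
    ridges, but in an even number of boundary ridges: it is on the horizon,
    between a visible and an invisible one. *)
Lemma boundary_add_vertex_new r : r \in boundary add_vertex -> z \in r ->
  exists p q, [/\ p |: r :\ z \in Vis, q |: r :\ z \in boundary B :\: Vis,
    p \notin r & q \notin r :\ z].
Proof.
move=> /[dup] /boundary_card rD; rewrite inE rD eqxx /= => odd_r zr.
pose e := r :\ z; have eD : #|e|.+2 = D by rewrite -rD (cardsD1 z r) zr.
have ze : z \notin e by rewrite !inE eqxx.
pose Q := [set q | (q \notin e) && (q |: e \in Vis)].
have zQ q : q \in Q -> z \notin q |: e.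
  by rewrite inE => /andP[_]; apply: notin_visible.
have degE : degree add_vertex r = #|Q|.
  rewrite -(@card_in_imset _ _ (fun q => z |: (q |: e))); last first.
    move=> q q' qQ q'Q E.
    have: q \in z |: (q' |: e) by rewrite -E !inE eqxx orbT.
    case/setU1P => [qz|/setU1P[//|qe]].
      by have := zQ q qQ; rewrite qz setU11.
    by move: qQ; rewrite inE qe.
  congr #|pred_of_set _|; apply/setP => S; rewrite inE.
  apply/andP/imsetP => [[/setUP[/notin_facet zS /subsetP/(_ z zr)|]]|[q qQ ->]].
    by rewrite (negbTE zS).
    case/imsetP => s sV -> rs; have zs := notin_visible sV.
    have es : e \subset s.
      apply/subsetP => v; rewrite !inE => /andP[vz /(subsetP rs)].
      by rewrite !inE (negbTE vz).
    have : #|s :\: e| == 1%N.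
      rewrite cardsD (setIidPr es); have := boundary_card (subsetP VisB _ sV).
      by rewrite -eD => -[->]; rewrite subSnn.
    case/cards1P => q qE.
    have sE : s = q |: e.
      rewrite -qE; apply/setP => w; rewrite in_setU in_setD.
      by have [/(subsetP es)->|] := boolP (w \in e); rewrite ?orbF.
    exists q; last by rewrite sE.
    have /setDP[_ qe] : q \in s :\: e by rewrite qE set11.
    by rewrite inE qe -sE.
  split; last by rewrite -(setD1K zr) setUS // subsetUr.
  by apply/setUP; right; apply: imset_f; move: qQ; rewrite inE => /andP[].
rewrite degE in odd_r; have := even_boundary_star BD eD.
set A := [set q | _] => even_A.
have QA : Q \subset A.
  by apply/subsetP => q; rewrite !inE => /andP[-> /(subsetP VisB)]; rewrite inE.
have /set0Pn[p pQ] : Q != set0 by rewrite -card_gt0 odd_gt0.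
have /subsetPn[q qA qQ] : ~~ (A \subset Q).
  apply: contraNN even_A => AQ; suff -> : A = Q by [].
  by apply/eqP; rewrite eqEsubset AQ QA.
exists p, q; have zp := zQ p pQ; move: pQ; rewrite inE => /andP[pe pV].
move: qA; rewrite inE => /andP[qe qB]; move: qQ; rewrite inE qe /= => qV.
split=> //; first by apply/setDP.
apply: contraNN zp => pr; move: pe; rewrite in_setD1 pr andbT negbK => /eqP->.
exact: setU11.
Qed.

End AddVertex.

End Boundary.

Section ConvexBall.
Variables (R : realType) (V : finType) (D : nat).
Local Open Scope ring_scope.
Implicit Types (B Vis : {set {set V}}) (S r s e : {set V}) (p q v z : V).

(** The [x v] are homogeneous coordinates of points of a space of dimension
    [D - 1] with heights [h v].  The functionals [L] make [B] the lower hull of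
    the lifted points, and the functionals [l] make its boundary ridges facets
    of the convex hull of the points. *)
Definition regular_ball B (x : V -> 'rV[R]_D) (h : V -> R)
    (L l : {set V} -> 'cV[R]_D) :=
  [/\ {in B, forall S, #|S| = D},
      {in B, forall S, supports (cover B) S (fun v => h v - pair (x v) (L S))} &
      {in boundary D B, forall r,
         supports (cover B) r (fun v => pair (x v) (l r))}].

Definition convex_ball B := exists x h L l, regular_ball B x h L l.

Lemma convex_ball_intro B (x : V -> 'rV[R]_D) (h : V -> R) : {in B, forall S, #|S| = D} ->
  {in B, forall S, exists L : 'cV_D,
     supports (cover B) S (fun v => h v - pair (x v) L)} ->
  {in boundary D B, forall r, exists l : 'cV_D,
     supports (cover B) r (fun v => pair (x v) l)} ->
  convex_ball B.
Proof.
move=> BD exL exl.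
have /choice[L LP] : forall S, exists L : 'cV_D,
    S \in B -> supports (cover B) S (fun v => h v - pair (x v) L).
  move=> S; have [/exL[L LP]|_] := boolP (S \in B); first by exists L.
  by exists 0.
have /choice[l lP] : forall r, exists l : 'cV_D,
    r \in boundary D B -> supports (cover B) r (fun v => pair (x v) l).
  move=> r; have [/exl[l lP]|_] := boolP (r \in _); first by exists l.
  by exists 0.
by exists x, h, L, l; split.
Qed.

Lemma simplex_convex_ball S0 : #|S0| = D -> convex_ball [set S0].
Proof.
move=> S0D; have [s s_inj sS] := set_enumeration S0D.
have coverE : cover [set S0] = S0 by rewrite /cover big_set1.
apply: (@convex_ball_intro _ (fun v => \row_i (s i == v)%:R) (fun=> 0)).
- by move=> S /set1P->.
- by move=> S /set1P->; exists 0 => v; rewrite coverE pair0r subr0 => ->.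
move=> r _; exists (\col_i (s i \notin r)%:R) => v; rewrite coverE => /sS[i ->].
rewrite /pair mxE (bigD1 i) //= !mxE eqxx mul1r big1 ?addr0 => [|j ji].
  by case: (s i \in r); rewrite /= ?ltr01.
by rewrite !mxE (inj_eq s_inj) (negbTE ji) mul0r.
Qed.

(** The height [H] of [z] exceeds the affine function of every old facet, so
    these stay lower facets.  The cone over a visible [r] is the zero set of a
    combination of the function of an old facet containing [r] and of the
    functional of [r], tilted until it meets [z].  A ridge through [z] has a
    visible and an invisible old ridge beside it, and the positive combination
    of their functionals that vanishes at [z] supports it. *)
Lemma place_vertex B Vis z x h L l (y : 'rV[R]_D) :
  regular_ball B x h L l -> z \notin cover B -> Vis \subset boundary D B ->
  {in boundary D B, forall r,
     if r \in Vis then pair y (l r) < 0 else 0 < pair y (l r)} ->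
  convex_ball (add_vertex B Vis z).
Proof.
move=> [BD BL Bl] zB VisB yl.
pose H : R := 1 + \sum_(S in B) `|pair y (L S)|.
have HL S : S \in B -> pair y (L S) < H.
  move=> SB; apply: le_lt_trans (ler_norm _) _; rewrite /H (bigD1 S) //=.
  rewrite addrCA ltrDl ltr_wpDr //.
  by apply: sumr_ge0.
pose x' v := if v == z then y else x v.
pose h' v := if v == z then H else h v.
have xz : x' z = y by rewrite /x' eqxx.
have hz : h' z = H by rewrite /h' eqxx.
have xW v : v \in cover B -> x' v = x v.
  by move=> vW; rewrite /x'; case: eqP => // vz; rewrite -vz vW in zB.
have hW v : v \in cover B -> h' v = h v.
  by move=> vW; rewrite /h'; case: eqP => // vz; rewrite -vz vW in zB.
have ext (Z : {set V}) (f : V -> R) :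
    (if z \in Z then f z = 0 else 0 < f z) -> supports (cover B) Z f ->
    supports (cover (add_vertex B Vis z)) Z f.
  move=> fz fB v /(subsetP (cover_add_vertex z VisB)) /setU1P[-> //|].
  exact: fB.
apply: (@convex_ball_intro _ x' h'); first exact: add_vertex_card.
- move=> S /setUP[SB|/imsetP[r rV ->]].
    exists (L S); apply: ext => [|v vW].
      by rewrite (negbTE (notin_facet zB SB)) xz hz subr_gt0 HL.
    by rewrite xW ?hW //; apply: BL.
  have rB := subsetP VisB _ rV; have [S0 S0B rS] := boundary_facet rB.
  have := yl r rB; rewrite rV => yr.
  pose c := (H - pair y (L S0)) / - pair y (l r).
  have c_gt0 : 0 < c by rewrite divr_gt0 ?subr_gt0 ?HL ?oppr_gt0.
  exists (L S0 - c *: l r); apply: ext => [|v vW].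
    rewrite setU11 xz hz !pairE /c opprB addrCA [X in X + _](_ : _ = - (H - pair y (L S0))).
      by rewrite addrC subrr.
    by rewrite invrN mulrN mulNr mulfVK ?lt_eqF.
  have vz : v != z by apply: contraNneq zB => <-.
  rewrite in_setU1 (negbTE vz) /= xW // hW // !pairE opprB addrCA.
  case: ifP => vr.
    rewrite (supports_eq0 (Bl _ rB)) // mulr0 add0r.
    by apply: (supports_eq0 (BL _ S0B)) => //; apply: (subsetP rS).
  apply: ltr_wpDr; first exact: (supports_ge0 (BL _ S0B)).
  by rewrite mulr_gt0 // (supports_gt0 (Bl _ rB)) ?vr.
move=> s sB'; have [zs|zs] := boolP (z \in s); last first.
  have /setDP[sB sV] := boundary_add_vertex_old zB VisB sB' zs.
  exists (l s); apply: ext => [|v vW].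
    by rewrite (negbTE zs) xz; have := yl s sB; rewrite (negbTE sV).
  by rewrite xW //; apply: Bl.
have [p [q [pV qB ps qs]]] := boundary_add_vertex_new BD zB VisB sB' zs.
move: pV qB; set r := p |: _; set r' := q |: _ => rV /setDP[r'B r'V].
have rB := subsetP VisB _ rV.
have := yl r rB; rewrite rV => yr; have := yl r' r'B; rewrite (negbTE r'V) => yr'.
exists (pair y (l r') *: l r - pair y (l r) *: l r'); apply: ext => [|v vW].
  by rewrite zs xz !pairE mulrC subrr.
have vz : v != z by apply: contraNneq zB => <-.
rewrite xW // !pairE -mulNr.
have g1 := supports_ge0 (Bl _ rB) vW; have g2 := supports_ge0 (Bl _ r'B) vW.
case: ifP => vs.
  by rewrite !(supports_eq0 (Bl _ _) vW) ?mulr0 ?addr0 // !inE vz vs orbT.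
have [vr|vr] := boolP (v \in r).
  apply: ltr_wpDl; first by rewrite mulr_ge0 // ltW.
  rewrite mulr_gt0 ?oppr_gt0 // (supports_gt0 (Bl _ r'B)) //.
  apply: contraNN r'V; move: vr; rewrite !inE vs andbF !orbF => /eqP-> /eqP pq.
  by rewrite /r' -pq.
apply: ltr_wpDr; last by rewrite mulr_gt0 // (supports_gt0 (Bl _ rB)).
by rewrite mulr_ge0 // oppr_ge0 ltW.
Qed.

Lemma small_scale (I : finType) (P : pred I) (a b : I -> R) :
  (forall i, P i -> 0 < a i) ->
  exists2 eps, 0 < eps & forall i, P i -> eps * b i < a i.
Proof.
move=> a_gt0; pose M := 1 + \sum_(i | P i) `|b i| / a i.
have term_ge0 i : P i -> 0 <= `|b i| / a i.
  by move=> /a_gt0/ltW a_ge0; rewrite divr_ge0.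
have M_gt0 : 0 < M by rewrite ltr_wpDr ?sumr_ge0.
exists M^-1; first by rewrite invr_gt0.
move=> i Pi; rewrite mulrC ltr_pdivrMr //.
apply: le_lt_trans (ler_norm _) _; rewrite mulrC -ltr_pdivrMr ?a_gt0 //.
rewrite /M (bigD1 i) //= addrCA ltrDl ltr_wpDr ?sumr_ge0 // => j /andP[/term_ge0].
by [].
Qed.

(** The sum of the vertices of [r0], moved slightly away from the interior. *)
Lemma point_beyond_ridge B x h L l r0 : regular_ball B x h L l ->
  r0 \in boundary D B ->
  exists y, {in boundary D B, forall r,
    if r == r0 then pair y (l r) < 0 else 0 < pair y (l r)}.
Proof.
move=> [BD BL Bl] r0B.
pose u : 'rV_D := \sum_(v in r0) x v; pose w : 'rV_D := \sum_(v in cover B) x v.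
have r0W := boundary_cover r0B.
have u0 : pair u (l r0) = 0.
  rewrite pair_suml big1 // => v vr; apply: (supports_eq0 (Bl _ r0B)) => //.
  exact: (subsetP r0W).
have u_gt0 r : (r \in boundary D B) && (r != r0) -> 0 < pair u (l r).
  case/andP=> rB rr0; have /subsetPn[v vr0 vr] : ~~ (r0 \subset r).
    by apply: contraNN rr0 => /(boundary_eq r0B rB)->.
  rewrite pair_suml (bigD1 v) //= ltr_wpDr //.
    apply: sumr_ge0 => p /andP[pr0 _]; apply: (supports_ge0 (Bl _ rB)).
    exact: (subsetP r0W).
  by apply: (supports_gt0 (Bl _ rB)) => //; apply: (subsetP r0W).
have w_gt0 : 0 < pair w (l r0).
  have [S SB rS] := boundary_facet r0B.
  have /subsetPn[v vS vr] : ~~ (S \subset r0).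
    apply: contraTN isT => /subset_leq_card.
    by rewrite BD // -(boundary_card r0B) ltnn.
  have vW : v \in cover B by apply/bigcupP; exists S.
  rewrite pair_suml (bigD1 v) //= ltr_wpDr ?(supports_gt0 (Bl _ r0B)) //.
  by apply: sumr_ge0 => p /andP[pW _]; apply: (supports_ge0 (Bl _ r0B)).
have [eps eps_gt0 eps_small] := small_scale (fun r => pair w (l r)) u_gt0.
exists (u - eps *: w) => r rB; rewrite !pairE; case: eqP => [->|/eqP rr0].
  by rewrite u0 sub0r oppr_lt0 mulr_gt0.
by rewrite subr_gt0 eps_small // rB.
Qed.

Lemma stack_facet B r0 z : convex_ball B -> r0 \in boundary D B ->
  z \notin cover B -> convex_ball ((z |: r0) |: B).
Proof.
move=> [x [h [L [l xB]]]] r0B zB; have [y yP] := point_beyond_ridge xB r0B.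
have := place_vertex (Vis := [set r0]) (y := y) xB zB.
rewrite /add_vertex imset_set1 setUC; apply; first by rewrite sub1set.
by move=> r rB; rewrite inE; apply: yP.
Qed.

(** The new point is [x v - eps *: y] with [y] beyond [r0] only.  A functional
    positive at [v] stays positive for small [eps], and one that vanishes at [v]
    has at the new point the sign opposite to that at [y]. *)
Lemma push_vertex B r0 v z : convex_ball B -> r0 \in boundary D B -> v \in r0 ->
  z \notin cover B ->
  convex_ball (add_vertex B [set r in boundary D B | (v \in r) && (r != r0)] z).
Proof.
move=> [x [h [L [l xB]]]] r0B vr0 zB; have [y yP] := point_beyond_ridge xB r0B.
have [_ _ Bl] := xB; have vW := subsetP (boundary_cover r0B) _ vr0.
have x_gt0 r : (r \in boundary D B) && (v \notin r) -> 0 < pair (x v) (l r).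
  by case/andP=> rB vr; apply: (supports_gt0 (Bl _ rB)).
have [eps eps_gt0 eps_small] := small_scale (fun r => pair y (l r)) x_gt0.
apply: (place_vertex (y := x v - eps *: y)) xB zB _ _.
  by apply/subsetP => r; rewrite inE => /andP[].
move=> r rB; rewrite inE rB !pairE /=; have [vr|vr] /= := boolP (v \in r).
  rewrite (supports_eq0 (Bl _ rB)) // sub0r oppr_lt0 oppr_gt0.
  by have := yP r rB; case: eqP => _ /= yr; rewrite (pmulr_rgt0, pmulr_rlt0).
by rewrite subr_gt0 eps_small // rB.
Qed.

End ConvexBall.

(** * The boundary of the join of a ball with an edge *)

Lemma is_facet_pure (V : finType) (J : {set {set V}}) k (F : {set V}) :
  {in J, forall G : {set V}, #|G| = k} ->
  is_facet (generated_complex [set` J]%classic) F <-> F \in J.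
Proof.
move=> Jk; split=> [[[G GJ FG] maxF]|FJ].
  by rewrite -(maxF G) //; exists G.
split; first by exists F.
move=> G [H HJ GH] FG; have FH := subset_trans FG GH.
have {}FH : F = H by apply/eqP; rewrite eqEcard FH !Jk ?leqnn.
by apply/eqP; rewrite eqEsubset FG {1}FH GH.
Qed.

Lemma subset_card_succ (V : finType) (G F : {set V}) :
  G \subset F -> #|F| = #|G|.+1 -> exists2 v, v \in F & G = F :\ v.
Proof.
move=> GF cF; have : #|F :\: G| == 1%N.
  by rewrite cardsD (setIidPr GF) cF subSnn.
case/cards1P => v vE; have /setDP[vF vG] : v \in F :\: G by rewrite vE set11.
exists v => //; apply/setP => w.
have := erefl (w \in F :\: G); rewrite {2}vE !inE.
have [->|nwv] := eqVneq w v; first by rewrite (negbTE vG).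
have [/(subsetP GF)->|] := boolP (w \in G); first by [].
by rewrite /= => _ /negbT/negbTE->.
Qed.

Section BoundaryNeighbours.
Variables (V : finType) (D : nat) (B : {set {set V}}).
Hypothesis BD : {in B, forall S : {set V}, #|S| = D}.
Implicit Types (S r s : {set V}) (v : V).

Lemma boundary_neighbour r v : r \in boundary D B -> v \in r ->
  exists2 r', r' \in boundary D B & v \notin r' /\ r :\ v \subset r'.
Proof.
move=> rB vr; pose e := r :\ v.
have eD : #|e|.+2 = D by rewrite -(boundary_card rB) (cardsD1 v r) vr.
have := even_boundary_star BD eD; set A := [set q | _] => even_A.
have ve : v \notin e by rewrite !inE eqxx.
have vA : v \in A by rewrite inE ve setD1K.
have /set0Pn[q] : A :\ v != set0.
  apply: contraNneq even_A => A0; move: (cardsD1 v A).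
  by rewrite vA A0 cards0 => ->.
case/setD1P => qv; rewrite inE => /andP[qe qB]; exists (q |: e) => //.
split; last exact: subsetUr.
by rewrite in_setU1 negb_or eq_sym qv.
Qed.

Lemma ridge_neighbour S v : S \in B -> v \in S ->
  S :\ v \in boundary D B \/
  exists2 S', S' \in B & S' != S /\ S :\ v \subset S'.
Proof.
move=> SB vS; have cS : #|S :\ v|.+1 = D by rewrite -(BD SB) (cardsD1 v S) vS.
rewrite inE cS eqxx /=; have [|even_deg] := boolP (odd _); first by left.
right; pose A := [set S' in B | S :\ v \subset S'].
have SA : S \in A by rewrite inE SB subsetDl.
have /set0Pn[S'] : A :\ S != set0.
  apply: contraNneq even_deg => A0; move: (cardsD1 S A).
  by rewrite SA A0 cards0 /degree => ->.
by case/setD1P => S'S; rewrite inE => /andP[S'B sub]; exists S'.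
Qed.

End BoundaryNeighbours.

Section EdgeJoin.
Variables (R : realType) (V : finType) (D : nat) (B : {set {set V}}) (a b : V).
Local Open Scope ring_scope.
Hypotheses (ab : a != b) (aB : a \notin cover B) (bB : b \notin cover B).
Implicit Types (S r s G F : {set V}) (v : V).

Definition edge_join : {set {set V}} := [set a |: (b |: S) | S in B].

Definition edge_sphere : {set {set V}} :=
  [set a |: S | S in B] :|: [set b |: S | S in B]
  :|: [set a |: (b |: r) | r in boundary D B].

Variant edge_sphere_spec : {set V} -> Prop :=
| EdgeSphereA S of S \in B : edge_sphere_spec (a |: S)
| EdgeSphereB S of S \in B : edge_sphere_spec (b |: S)
| EdgeSphereAB r of r \in boundary D B : edge_sphere_spec (a |: (b |: r)).

Lemma edge_sphereP F : reflect (edge_sphere_spec F) (F \in edge_sphere).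
Proof.
apply: (iffP idP).
  by rewrite !inE => /orP[/orP[]|] /imsetP[S SB ->]; constructor.
case=> S SB; rewrite !in_setU.
- by rewrite (imset_f (setU [set a])).
- by rewrite (imset_f (setU [set b])) ?orbT.
- by rewrite (imset_f (fun r => a |: (b |: r))) ?orbT.
Qed.

Variables (x : V -> 'rV[R]_D) (h : V -> R) (L l : {set V} -> 'cV[R]_D).
Hypothesis xB : regular_ball B x h L l.
Variable (r0 : {set V}).
Hypothesis r0B : r0 \in boundary D B.

Let BD : {in B, forall S, #|S| = D}. Proof. by case: xB. Qed.

Let S0 : {set V} := odflt set0 [pick S in B].

Let S0B : S0 \in B.
Proof.
rewrite /S0; case: pickP => //= noS; have [S SB _] := boundary_facet r0B.
by rewrite noS in SB.
Qed.

(** [phi] is positive on all vertices, since no vertex lies in all boundary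
    ridges. *)
Let phi : 'cV[R]_D := \sum_(r in boundary D B) l r.

(** In the coordinates (x, h, y) of the space of dimension [D.+2], with y = h on
    the ball, [psi] is the value of the functional phi + h + y - 2 L_(S0).  It
    is positive on the ball and takes the value 1 at a = (0, 0, 1) and
    b = (0, 1, 0), so that dividing by it gives affine coordinates. *)
Let psi v : R := pair (x v) phi + 2 * (h v - pair (x v) (L S0)).

Lemma psi_gt0 v : v \in cover B -> 0 < psi v.
Proof.
move=> vW; have [_ BL Bl] := xB.
apply: ltr_wpDr; first by rewrite mulr_ge0 ?(supports_ge0 (BL _ S0B)) ?ler0n.
have [r rB vr] : exists2 r, r \in boundary D B & v \notin r.
  have [vr0|] := boolP (v \in r0); last by exists r0.
  by have [r rB [vr _]] := boundary_neighbour BD r0B vr0; exists r.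
rewrite /phi pair_sumr (bigD1 r) //= ltr_wpDr ?(supports_gt0 (Bl _ rB)) //.
by apply: sumr_ge0 => s /andP[sB _]; apply: (supports_ge0 (Bl _ sB)).
Qed.

Let point (c t : R) (u : 'rV[R]_D) : 'rV[R]_D.+1 :=
  c *: row_mx (t%:M : 'rV_1) u.

Let functional (c t : R) (m : 'cV[R]_D) : 'cV[R]_D.+2 :=
  affine_functional c (affine_functional t m : 'cV_D.+1).

Let pair_point c t u c' t' m :
  pair (homvec (point c t u)) (functional c' t' m) = c' + c * (t * t' + pair u m).
Proof.
rewrite pair_affine pairZl; congr (_ + _ * _).
rewrite /pair /affine_functional (@mul_row_col _ 1 1 D 1) mxE.
by congr (_ + _); rewrite mul_scalar_mx !mxE mulr1n.
Qed.

(** The coordinates (h, x) divided by the value of [psi]; the coordinate y is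
    eliminated through [psi]. *)
Definition edge_point v : 'rV[R]_D.+1 :=
  if v == a then 0 else if v == b then point 1 1 0
  else point (psi v)^-1 (h v) (x v).

(** The three cases are l_r, h - L_S and y - L_S, written affinely in (h, x) by
    means of y = psi - phi - h + 2 L_(S0). *)
Definition edge_functional F : 'cV[R]_D.+2 :=
  if a \in F then
    if b \in F then functional 0 0 (l (F :\ a :\ b))
    else functional 0 1 (- L (F :\ a))
  else functional 1 (- 1) (- (phi - 2 *: L S0 + L (F :\ b))).

Let notin_a S : S \in B -> a \notin S.
Proof. exact: notin_facet aB S. Qed.
Let notin_b S : S \in B -> b \notin S.
Proof. exact: notin_facet bB S. Qed.

Let notin_ridge r : r \in boundary D B -> (a \notin r) /\ (b \notin r).
Proof.
move=> /boundary_cover /subsetP rB.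
by split; [apply: contraNN aB => /rB | apply: contraNN bB => /rB].
Qed.

Lemma edge_sphere_supports : {in edge_sphere, forall F,
  supports (a |: (b |: cover B)) F
    (fun v => pair (homvec (edge_point v)) (edge_functional F))}.
Proof.
have [_ BL Bl] := xB.
have pa c t m : pair (homvec (edge_point a)) (functional c t m) = c.
  by rewrite /edge_point eqxx pair_affine pair0l addr0.
have pb c t m : pair (homvec (edge_point b)) (functional c t m) = c + t.
  rewrite /edge_point eq_sym (negbTE ab) eqxx pair_point pair0l.
  by rewrite addr0 !mul1r.
have pv v c t m : v \in cover B -> pair (homvec (edge_point v)) (functional c t m)
    = c + (psi v)^-1 * (h v * t + pair (x v) m).
  move=> vW; rewrite /edge_point; case: eqP => [va|_].
    by move: aB; rewrite -va vW.
  case: eqP => [vb|_]; first by move: bB; rewrite -vb vW.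
  exact: pair_point.
have nav v : v \in cover B -> v != a by move=> vW; apply: contraNneq aB => <-.
have nbv v : v \in cover B -> v != b by move=> vW; apply: contraNneq bB => <-.
move=> _ /edge_sphereP[S SB|S SB|r rB] v.
- have -> : edge_functional (a |: S) = functional 0 1 (- L S).
    rewrite /edge_functional setU11 !inE eq_sym (negbTE ab) (negbTE (notin_b SB)).
    by rewrite setU1K ?notin_a.
  case/setU1P => [->|/setU1P[->|vW]]; first by rewrite setU11 pa.
    rewrite !inE eq_sym (negbTE ab) (negbTE (notin_b SB)) /= pb add0r.
    exact: ltr01.
  rewrite pv // add0r mulr1 pairNr in_setU1 (negbTE (nav _ vW)) /=.
  have := BL _ SB v vW; case: ifP => _; first by move->; rewrite mulr0.
  by move=> ?; rewrite mulr_gt0 // invr_gt0 psi_gt0.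
- have -> : edge_functional (b |: S) =
      functional 1 (- 1) (- (phi - 2 *: L S0 + L S)).
    rewrite /edge_functional !inE (negbTE ab) (negbTE (notin_a SB)) /=.
    by rewrite setU1K ?notin_b.
  case/setU1P => [->|/setU1P[->|vW]].
  + by rewrite !inE (negbTE ab) (negbTE (notin_a SB)) /= pa ltr01.
  + by rewrite setU11 pb subrr.
  rewrite pv // in_setU1 (negbTE (nbv _ vW)) /=.
  have psi_neq0 : psi v != 0 by rewrite gt_eqF ?psi_gt0.
  have -> : 1 + (psi v)^-1 * (h v * -1 + pair (x v) (- (phi - 2 *: L S0 + L S)))
      = (psi v)^-1 * (h v - pair (x v) (L S)).
    rewrite -[X in X + _](mulVf psi_neq0) -mulrDr; congr (_ * _).
    by rewrite !pairE /psi; lra.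
  have := BL _ SB v vW; case: ifP => _; first by move->; rewrite mulr0.
  by move=> ?; rewrite mulr_gt0 // invr_gt0 psi_gt0.
have [ar br] := notin_ridge rB.
have -> : edge_functional (a |: (b |: r)) = functional 0 0 (l r).
  rewrite /edge_functional setU11 in_setU1 setU11 orbT setU1K ?setU1K //.
  by rewrite in_setU1 negb_or ab.
case/setU1P => [->|/setU1P[->|vW]]; first by rewrite setU11 pa.
  by rewrite in_setU1 setU11 orbT pb addr0.
rewrite pv // !in_setU1 (negbTE (nav _ vW)) (negbTE (nbv _ vW)) /=.
rewrite mulr0 !add0r.
have := Bl _ rB v vW; case: ifP => _; first by move->; rewrite mulr0.
by move=> ?; rewrite mulr_gt0 // invr_gt0 psi_gt0.
Qed.

Lemma edge_sphere_pseudosphere :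
  supported_pseudosphere (fun v => homvec (edge_point v)) edge_functional edge_sphere.
Proof.
split.
- by apply/set0Pn; exists (a |: S0); apply/edge_sphereP; constructor.
- move=> _ /edge_sphereP[S SB|S SB|r rB].
  + by rewrite cardsU1 notin_a // BD.
  + by rewrite cardsU1 notin_b // BD.
  + have [ar br] := notin_ridge rB.
    by rewrite !cardsU1 !inE (negbTE ab) (negbTE ar) br -(boundary_card rB).
- move=> F FE; apply: supports_sub (edge_sphere_supports FE).
  apply/bigcupsP => _ /edge_sphereP[S SB|S SB|r rB].
  + apply: setUS; apply: subset_trans (subsetUr _ _).
    exact: bigcup_sup.
  + by apply: subset_trans (subsetUr _ _); apply: setUS; apply: bigcup_sup.
  + by do 2 apply: setUS; apply: boundary_cover rB.
have nba S : S \in B -> b \notin a |: S.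
  by move=> SB; rewrite in_setU1 negb_or eq_sym ab notin_b.
have nab S : S \in B -> a \notin b |: S.
  by move=> SB; rewrite in_setU1 negb_or ab notin_a.
have neq c F F' : c \in F' -> c \notin F -> F' != F.
  by move=> cF'; apply: contraNneq => <-.
move=> _ v /edge_sphereP[S SB|S SB|r rB].
- case/setU1P => [->|vS].
    exists (b |: S); first by apply/edge_sphereP; constructor.
    split; first by apply: (neq b); rewrite ?setU11 ?nba.
    by rewrite setU1K ?notin_a // subsetUr.
  have va : a != v by apply: contraNneq (notin_a SB) => ->.
  have E : (a |: S) :\ v = a |: S :\ v.
    rewrite setDUl; congr (_ :|: _); apply/setP => w.
    by rewrite !inE andb_idl // => /eqP->.
  rewrite E; have [rB|[S' S'B [S'S sub]]] := ridge_neighbour BD SB vS.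
    exists (a |: (b |: S :\ v)); first by apply/edge_sphereP; constructor.
    split; last by apply: setUS; apply: subsetUr.
    by apply: (neq b); rewrite ?nba // in_setU1 setU11 orbT.
  exists (a |: S'); first by apply/edge_sphereP; constructor.
  split; last exact: setUS.
  apply: contraNneq S'S => E'.
  by rewrite -(setU1K (notin_a S'B)) E' setU1K ?notin_a.
- case/setU1P => [->|vS].
    exists (a |: S); first by apply/edge_sphereP; constructor.
    split; first by apply: (neq a); rewrite ?setU11 ?nab.
    by rewrite setU1K ?notin_b // subsetUr.
  have vb : b != v by apply: contraNneq (notin_b SB) => ->.
  have E : (b |: S) :\ v = b |: S :\ v.
    rewrite setDUl; congr (_ :|: _); apply/setP => w.
    by rewrite !inE andb_idl // => /eqP->.
  rewrite E; have [rB|[S' S'B [S'S sub]]] := ridge_neighbour BD SB vS.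
    exists (a |: (b |: S :\ v)); first by apply/edge_sphereP; constructor.
    split; last exact: subsetUr.
    by apply: (neq a); rewrite ?nab // setU11.
  exists (b |: S'); first by apply/edge_sphereP; constructor.
  split; last exact: setUS.
  apply: contraNneq S'S => E'.
  by rewrite -(setU1K (notin_b S'B)) E' setU1K ?notin_b.
have [ar br] := notin_ridge rB; have [S SB rS] := boundary_facet rB.
case/setU1P => [->|/setU1P[->|vr]].
- exists (b |: S); first by apply/edge_sphereP; constructor.
  split; first by rewrite eq_sym; apply: (neq a); rewrite ?setU11 ?nab.
  by rewrite setU1K ?setUS // in_setU1 negb_or ab.
- exists (a |: S); first by apply/edge_sphereP; constructor.
  split.
    by rewrite eq_sym; apply: (neq b); rewrite ?nba // in_setU1 setU11 orbT.
  rewrite setUCA setU1K ?setUS // in_setU1 negb_or eq_sym ab; exact: br.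
have [r' r'B [vr' sub]] := boundary_neighbour BD rB vr.
exists (a |: (b |: r')); first by apply/edge_sphereP; constructor.
split.
  rewrite eq_sym; apply: (neq v); first by rewrite !in_setU1 vr !orbT.
  rewrite !in_setU1 (negbTE vr') orbF negb_or.
  by apply/andP; split; [apply: contraNneq ar|apply: contraNneq br] => <-.
apply/subsetP => w /setD1P[wv]; rewrite !in_setU1 => /or3P[->//|->|wr].
  by rewrite orbT.
by rewrite (subsetP sub) ?orbT // in_setD1 wv.
Qed.

(** Three facets of the ball sharing [r] would give three facets of the sphere
    sharing [a |: r]. *)
Lemma degree_le2 r : #|r|.+1 = D -> (degree B r <= 2)%N.
Proof.
move=> rD; rewrite leqNgt; apply/negP.
case/card_gt2P => S1 [S2 [S3 [[]]]].
rewrite !inE => /andP[S1B r1] /andP[S2B r2] /andP[S3B r3] [n12 n23 n31].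
have inj S S' : S \in B -> S' \in B -> S != S' -> a |: S != a |: S'.
  move=> SB S'B; apply: contraNneq => E.
  by rewrite -(setU1K (notin_a SB)) E setU1K ?notin_a.
have ar : a \notin r by apply: contraNN (notin_a S1B); apply/subsetP.
apply: (@ridge_in_two_facets _ _ _ _ _ _ edge_sphere_pseudosphere (a |: r)
  (a |: S1) (a |: S2) (a |: S3)); rewrite ?setUS ?inj //.
- by rewrite cardsU1 ar add1n rD.
- by apply/edge_sphereP; constructor.
- by apply/edge_sphereP; constructor.
- by apply/edge_sphereP; constructor.
Qed.

(** Removing from a facet [a |: (b |: S)] the vertex [b] or [a] always leaves a
    boundary face; removing a vertex of [S] does so exactly if the remaining
    ridge of [S] lies in no other facet. *)
Lemma complex_boundary_edge_join :
  complex_boundary D.+1 (generated_complex [set` edge_join]%classic) =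
  generated_complex [set` edge_sphere]%classic.
Proof.
have joinD : {in edge_join, forall F, #|F| = D.+2}.
  move=> _ /imsetP[S SB ->].
  by rewrite !cardsU1 !inE (negbTE ab) (negbTE (notin_a SB)) notin_b // BD.
have strip S (X : {set V}) : S \in B -> X \subset a |: (b |: S) -> X :\ a :\ b \subset S.
  move=> SB /subsetP sub; apply/subsetP => w /setD1P[wb /setD1P[wa /sub]].
  by rewrite !in_setU1 (negbTE wa) (negbTE wb).
have stripK S : S \in B -> (a |: (b |: S)) :\ a :\ b = S.
  by move=> SB; rewrite !setU1K ?notin_b // in_setU1 negb_or ab notin_a.
have stripS S S' : S \in B -> S' \in B -> S \subset S' -> S = S'.
  by move=> SB S'B sub; apply/eqP; rewrite eqEcard sub !BD ?leqnn.
congr generated_complex; apply/seteqP; split=> G /=.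
  move=> [GD [F [[/(is_facet_pure _ joinD) FJ GF] uniqF]]].
  have [v vF GE] : exists2 v, v \in F & G = F :\ v.
    by apply: subset_card_succ => //; rewrite (joinD F FJ) GD.
  case/imsetP: FJ vF uniqF GE => S SB -> {F GF}.
  have aS : a \notin b |: S by rewrite in_setU1 negb_or ab notin_a.
  case/setU1P => [->|/setU1P[->|vS]] uniqF GE; rewrite GE.
  - by rewrite setU1K //; apply/edge_sphereP; constructor.
  - rewrite setUCA setU1K; first by apply/edge_sphereP; constructor.
    by rewrite in_setU1 negb_or eq_sym ab notin_b.
  have E : (a |: (b |: S)) :\ v = a |: (b |: S :\ v).
    apply/setP => w; rewrite !inE; have [->|//] := eqVneq w v.
    have [va vb] : v != a /\ v != b.
      by split; [apply: contraNneq (notin_a SB)|apply: contraNneq (notin_b SB)] => <-.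
    by rewrite (negbTE va) (negbTE vb).
  rewrite E; have [rB|[S' S'B [S'S sub]]] := ridge_neighbour BD SB vS.
    by apply/edge_sphereP; constructor.
  case/eqP: S'S; rewrite -(stripK S') // -(stripK S) //; congr (_ :\ a :\ b).
  apply/esym/uniqF; split; last by rewrite GE E; do 2 apply: setUS.
  by apply/(is_facet_pure _ joinD); apply: imset_f.
move=> /[dup] /edge_sphereP GE GF.
split; first by case: edge_sphere_pseudosphere => _ + _ _; apply.
suff [S [SB GS] uniqS] : exists2 S, S \in B /\ G \subset a |: (b |: S) &
    forall S', S' \in B -> G \subset a |: (b |: S') -> S' = S.
  exists (a |: (b |: S)); split=> [|F [/(is_facet_pure _ joinD)]].
    by split=> //; apply/(is_facet_pure _ joinD); apply: imset_f.
  by case/imsetP => S' S'B -> /(uniqS _ S'B)->.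
case: GE => [S SB|S SB|r rB] {GF G}.
- exists S; first by split=> //; rewrite setUS ?subsetUr.
  move=> S' S'B /(strip _ _ S'B).
  rewrite setU1K ?notin_a // => /(subset_trans _)-sub.
  apply/esym/stripS => //; apply: sub.
  by apply/subsetP => w wS; rewrite in_setD1 wS andbT; apply: contraNneq (notin_b SB) => <-.
- exists S; first by split=> //; rewrite subsetUr.
  move=> S' S'B /(strip _ _ S'B)/subsetP sub.
  apply/esym/stripS => //; apply/subsetP => w wS; apply: sub.
  rewrite !inE wS orbT andbT.
  by apply/andP; split; [apply: contraNneq (notin_b SB)|apply: contraNneq (notin_a SB)] => <-.
have [S SB rS] := boundary_facet rB; have [ar br] := notin_ridge rB.
exists S; first by split=> //; do 2 apply: setUS.
move=> S' S'B /(strip _ _ S'B).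
rewrite !setU1K // ?in_setU1 ?negb_or ?ab // => rS'.
apply/eqP; apply: contraT => nS.
have : degree B r == 2.
  rewrite eqn_leq degree_le2 ?(boundary_card rB) //= /degree.
  have <- : #|[set S; S']| = 2 by rewrite cards2 eq_sym nS.
  apply: subset_leq_card; apply/subsetP => T; rewrite !inE => /orP[]/eqP->.
    by rewrite SB.
  by rewrite S'B.
by move=> /eqP deg2; move: rB; rewrite inE deg2 andbF.
Qed.

End EdgeJoin.

Theorem edge_join_polytopal (R : realType) (V : finType) (D : nat)
    (B : {set {set V}}) (a b : V) : a != b -> a \notin cover B ->
  b \notin cover B -> convex_ball R D B -> boundary D B != set0 ->
  polytopal R D.+1
    (complex_boundary D.+1 (generated_complex [set` edge_join B a b]%classic)).
Proof.
move=> ab aB bB [x [h [L [l xB]]]] /set0Pn[r0 r0B].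
rewrite (complex_boundary_edge_join ab aB bB xB r0B).
exact: pseudosphere_polytopal (edge_sphere_pseudosphere ab aB bB xB r0B) _.
Qed.

(** * Staircase balls *)

Lemma degree_eq1 (V : finType) (B : {set {set V}}) (r S : {set V}) :
  S \in B -> r \subset S -> (forall S', S' \in B -> r \subset S' -> S' = S) ->
  degree B r = 1.
Proof.
move=> SB rS uniqS; rewrite /degree (_ : [set _ in _ | _] = [set S]) ?cards1 //.
apply/setP => S'; rewrite !inE; apply/andP/eqP => [[]|->//]; exact: uniqS.
Qed.

Lemma degree_eq2 (V : finType) (B : {set {set V}}) (r S S' : {set V}) :
  S \in B -> S' \in B -> r \subset S -> r \subset S' -> S != S' ->
  (forall T, T \in B -> r \subset T -> T = S \/ T = S') -> degree B r = 2.
Proof.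
move=> SB S'B rS rS' nS two.
rewrite /degree (_ : [set _ in _ | _] = [set S; S']) ?cards2 ?nS //.
apply/setP => T; rewrite !inE; apply/andP/orP => [[TB rT]|[]/eqP->//].
by case: (two T TB rT) => ->; rewrite eqxx; [left|right].
Qed.

Section StaircaseBall.
Variable n : nat.
Implicit Types (S r : {set 'I_n}) (s t : seq nat) (E : rel nat).

(** Faces are given by explicit lists of numbers, which keeps inclusions
    decidable by arithmetic. *)
Definition ords s : {set 'I_n} := [set v : 'I_n | (v : nat) \in s].

Definition below s := all (fun m => m < n) s.

Lemma sub_ords s t : below s -> (ords s \subset ords t) = all (mem t) s.
Proof.
move=> /allP sn; apply/subsetP/allP => [sub m ms|sub v]; last first.
  by rewrite !inE => /sub.
by have := sub (Ordinal (sn m ms)); rewrite !inE; apply.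
Qed.

Lemma card_ords s : uniq s -> below s -> #|ords s| = size s.
Proof.
move=> s_uniq sn; rewrite -(size_map (insub : nat -> option 'I_n)).
rewrite cardE -(size_map Some); apply/perm_size/uniq_perm.
- by rewrite map_inj_uniq ?enum_uniq // => v w [].
- rewrite map_inj_in_uniq // => i j /(allP sn) iltn /(allP sn) jltn.
  by rewrite !insubT => -[].
move=> o; apply/mapP/mapP => [[v]|[m ms ->]].
  by rewrite mem_enum inE => vs ->; exists (v : nat); rewrite ?valK.
have mn := allP sn m ms; exists (Ordinal mn); last by rewrite insubT.
by rewrite mem_enum inE.
Qed.

Definition tet i k := ords [:: i; i.+1; k; k.+1].

Definition tri i j k := ords [:: i; j; k].

(** The ball on the vertices a, ..., c.  The facets with [k.+1 = c] are always
    present, so that the link of [c] contains the whole path from [a] to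
    [c.-1]. *)
Definition staircase E a c : {set {set 'I_n}} :=
  [set S | [exists i : 'I_n, exists k : 'I_n, [&& S == tet i k, a <= i,
     i.+2 <= k, k < c & E i k || (k.+1 == c)]]].

Variant staircase_spec E a c : {set 'I_n} -> Prop :=
  StaircaseTet i k of a <= i & i.+2 <= k & k < c & E i k || (k.+1 == c) :
    staircase_spec E a c (tet i k).

Lemma staircaseP E a c S : c < n ->
  reflect (staircase_spec E a c S) (S \in staircase E a c).
Proof.
move=> cn; apply: (iffP idP).
  rewrite inE => /existsP[i /existsP[k /and5P[/eqP-> ai ik kc Eik]]].
  by constructor.
case=> i k ai ik kc Eik; rewrite inE.
have kn : k < n by lia.
have i_n : i < n by lia.
apply/existsP; exists (Ordinal i_n); apply/existsP; exists (Ordinal kn).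
by rewrite /= eqxx ai ik kc.
Qed.

Lemma card_tet i k : i.+2 <= k -> k.+1 < n -> #|tet i k| = 4.
Proof.
move=> ik kn; rewrite card_ords //=; first by rewrite !inE; lia.
by rewrite /below /=; lia.
Qed.

Lemma card_tri i j k : i < j -> j < k -> k < n -> #|tri i j k| = 3.
Proof.
move=> ij jk kn; rewrite card_ords //=; first by rewrite !inE; lia.
by rewrite /below /=; lia.
Qed.

Lemma tri_sub_tet p q m i k : p < q -> q < m -> m < n ->
  (tri p q m \subset tet i k) =
  [&& p \in [:: i; i.+1; k; k.+1], q \in [:: i; i.+1; k; k.+1]
    & m \in [:: i; i.+1; k; k.+1]].
Proof.
move=> pq qm mn; rewrite sub_ords /= ?andbT //.
by rewrite /below /=; lia.
Qed.

Lemma staircase_card E a c : c < n -> {in staircase E a c, forall S, #|S| = 4}.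
Proof.
by move=> cn S /(staircaseP _ _ _ cn)[i k ai ik kc _]; apply: card_tet; lia.
Qed.

Lemma staircase_cover E a c v : c < n -> v \in cover (staircase E a c) ->
  a <= v <= c.
Proof.
move=> cn /bigcupP[S /(staircaseP _ _ _ cn)[i k ai ik kc _]].
by rewrite !inE; lia.
Qed.

Lemma boundary_last E a c : a.+3 <= c -> c < n ->
  tri a c.-1 c \in boundary 4 (staircase E a c).
Proof.
move=> ac cn; rewrite inE card_tri ?eqxx /=; try lia.
rewrite (@degree_eq1 _ _ _ (tet a c.-1)) //.
- by apply/staircaseP => //; constructor; lia.
- by rewrite tri_sub_tet ?inE; lia.
move=> _ /(staircaseP _ _ _ cn)[i k ai ik kc _].
rewrite tri_sub_tet ?inE; try lia; move=> sub.
have -> : i = a by lia.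
by have -> : k = c.-1 by lia.
Qed.

(** The facet containing this triangle is [tet i c.-1], or [tet i.-1 c.-1] if
    [i.+2 = c]; the minimum treats both. *)
Lemma boundary_top E a c i : a.+3 <= c -> c < n -> a <= i -> i.+2 <= c ->
  tri i i.+1 c \in boundary 4 (staircase E a c).
Proof.
move=> ac cn ai ic; rewrite inE card_tri ?eqxx /=; try lia.
rewrite (@degree_eq1 _ _ _ (tet (minn i (c - 3)) c.-1)) //.
- by apply/staircaseP => //; constructor; lia.
- by rewrite tri_sub_tet ?inE; lia.
move=> _ /(staircaseP _ _ _ cn)[i' k ai' ik kc _].
rewrite tri_sub_tet ?inE; try lia; move=> sub.
have -> : i' = minn i (c - 3) by lia.
by have -> : k = c.-1 by lia.
Qed.

Lemma interior_top E a c j : c < n -> a < j -> j.+3 <= c ->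
  tri j c.-1 c \notin boundary 4 (staircase E a c).
Proof.
move=> cn aj jc; rewrite inE negb_and; apply/orP; right.
rewrite (@degree_eq2 _ _ _ (tet j c.-1) (tet j.-1 c.-1)) //.
- by apply/staircaseP => //; constructor; lia.
- by apply/staircaseP => //; constructor; lia.
- by rewrite tri_sub_tet ?inE; lia.
- by rewrite tri_sub_tet ?inE; lia.
- apply: contraTneq (subxx (tet j c.-1)) => {2}->.
  by rewrite sub_ords /below /= ?inE; lia.
move=> _ /(staircaseP _ _ _ cn)[i k ai ik kc _].
rewrite tri_sub_tet ?inE; try lia; move=> sub.
have -> : k = c.-1 by lia.
by have [->|->] : i = j \/ i = j.-1; [lia | left | right].
Qed.

(** The last vertex lies on a fan of boundary triangles over the path from [a]
    to [c.-1], closed by the triangle on the edge from [a] to [c.-1]: all other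
    triangles at [c] are shared by two facets ([interior_top]). *)
Lemma boundary_star_last E a c (v : 'I_n) r : a.+3 <= c -> c < n ->
  v = c :> nat -> r \in boundary 4 (staircase E a c) -> v \in r ->
  r != tri a c.-1 c -> exists i, [/\ a <= i, i.+2 <= c & r = tri i i.+1 c].
Proof.
move=> ac cn vc rB vr r0.
have [S SB rS] := boundary_facet rB; have SD := staircase_card cn SB.
have [w wS rE] : exists2 w, w \in S & r = S :\ w.
  by apply: subset_card_succ => //; rewrite SD (boundary_card rB).
move: vr; rewrite rE => /setD1P[vw vS].
have {vw} vw : c != w :> nat by rewrite -vc (inj_eq val_inj).
case/(staircaseP _ _ _ cn): SB wS vS rE {rS SD} => i k ai ik kc _.
rewrite !inE vc => wS vS rE; rewrite -rE.
have rT p q m : (forall u : nat, (u \in [:: p; q; m]) =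
    (u != w) && (u \in [:: i; i.+1; k; k.+1])) -> r = tri p q m.
  by move=> pqm; rewrite rE; apply/setP => u; rewrite in_setD1 !in_set pqm.
have [wk|wk] := eqVneq (w : nat) k.
  exists i; split=> //; first by lia.
  by apply: rT => u; rewrite !inE; lia.
have [wi|wi] := eqVneq (w : nat) i.
  have rE' : r = tri i.+1 c.-1 c by apply: rT => u; rewrite !inE; lia.
  have [ic|ic] := leqP i.+4 c.
    have ai1 : a < i.+1 by lia.
    by case/negP: (interior_top E cn ai1 ic); rewrite -rE'.
  exists i.+1; split; [lia | lia |]; apply: rT => u; rewrite !inE; lia.
have rE' : r = tri i c.-1 c by apply: rT => u; rewrite !inE; lia.
have [ia|ia] := eqVneq i a; first by rewrite rE' ia eqxx in r0.
have ai' : a < i by lia.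
have ic : i.+3 <= c by lia.
by case/negP: (interior_top E cn ai' ic); rewrite -rE'.
Qed.

Section Realization.
Variables (R : realType) (E : rel nat) (top : nat).
Hypothesis top_lt : top < n.
Hypothesis E_up : forall i k i' k', E i k -> i <= i' -> k <= k' ->
  i'.+2 <= k' -> k'.+2 <= top -> E i' k'.

Lemma staircase_base a : a.+3 < n -> staircase E a a.+3 = [set tet a a.+2].
Proof.
move=> an; apply/setP => S; rewrite in_set1; apply/(staircaseP _ _ _ an)/eqP.
  case=> i k ai ik kc _; have -> : i = a by lia.
  by have -> : k = a.+2 by lia.
by move=> ->; constructor; lia.
Qed.

(** As [E] is an up-set, the vertex [a] lies only in the facet [tet a c.-1] if
    the pair [(a, c.-2)] is missing. *)
Lemma staircase_skip_first a c : a.+4 <= c -> c <= top -> ~~ E a c.-2 ->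
  exists2 v : 'I_n, v = a :> nat &
    staircase E a c = (v |: tri a.+1 c.-1 c) |: staircase E a.+1 c.
Proof.
move=> ac ctop nE; have cn : c < n by lia.
have an : a < n by lia.
exists (Ordinal an) => //; have tE : Ordinal an |: tri a.+1 c.-1 c = tet a c.-1.
  by apply/setP => u; rewrite !inE -val_eqE /=; lia.
rewrite tE; apply/setP => S; rewrite in_setU1.
apply/(staircaseP _ _ _ cn)/predU1P => [[i k ai ik kc Eik]|[->|]].
- have [ia|ia] := eqVneq i a; last first.
    by right; apply/staircaseP => //; constructor => //; lia.
  left; rewrite ia; suff -> : k = c.-1 by [].
  case/orP: Eik => [Eik|]; last by lia.
  have [//|kc'] := eqVneq k c.-1.
  by case/negP: nE; apply: (E_up Eik); lia.
- by constructor; lia.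
- by case/(staircaseP _ _ _ cn) => i k ai ik kc Eik; constructor => //; lia.
Qed.

(** If the pair [(a, c.-2)] is present, then all facets [tet i c.-2] are, and
    the facets without [c] form the ball on a, ..., c.-1.  The others are the
    cones from [c] over the fan of [boundary_star_last]. *)
Lemma staircase_push_last a c : a.+4 <= c -> c <= top -> E a c.-2 ->
  exists (v z : 'I_n) , [/\ v = c.-1 :> nat, z = c :> nat & staircase E a c =
    add_vertex (staircase E a c.-1)
      [set r in boundary 4 (staircase E a c.-1) |
         (v \in r) && (r != tri a c.-2 c.-1)] z].
Proof.
move=> ac ctop Eac; have cn : c < n by lia.
have cn' : c.-1 < n by lia.
exists (Ordinal cn'), (Ordinal cn); split=> //; apply/setP => S.
have zE i : Ordinal cn |: tri i i.+1 c.-1 = tet i c.-1.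
  by apply/setP => u; rewrite !inE -val_eqE /=; lia.
apply/(staircaseP _ _ _ cn)/setUP => [[i k ai ik kc Eik]|[]].
- have [kE|kE] := eqVneq k c.-1; last first.
    by left; apply/staircaseP => //; constructor => //; lia.
  right; apply/imsetP; exists (tri i i.+1 c.-1); last by rewrite zE kE.
  rewrite inE boundary_top ?inE /=; try lia.
  rewrite eqxx !orbT /=; apply/eqP => /setP sT.
  have inn : i.+1 < n by lia.
  have := sT (Ordinal inn); have i_n : i < n by lia.
  by have := sT (Ordinal i_n); rewrite !inE /=; lia.
- case/(staircaseP _ _ _ cn') => i k ai ik kc Eik; constructor => //; first lia.
  case/orP: Eik => [->//|kE]; rewrite (E_up Eac) //; lia.
case/imsetP => r; rewrite inE => /and3P[rB vr r0] ->.
have ac' : a.+3 <= c.-1 by lia.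
have [i [ai ic ->]] :=
  @boundary_star_last _ _ _ (Ordinal cn') _ ac' cn' erefl rB vr r0.
by rewrite zE; constructor; lia.
Qed.

(** The pair [(a, c.-2)] decides which end of the interval is placed last. *)
Theorem staircase_convex_ball a c : a.+3 <= c -> c <= top ->
  convex_ball R 4 (staircase E a c).
Proof.
move=> ac; have [m cE] : exists m, c = a.+3 + m by exists (c - a.+3); lia.
elim: m a c cE ac => [|m IH] a c cE ac ctop.
  have -> : c = a.+3 by lia.
  rewrite staircase_base; last by lia.
  by apply: simplex_convex_ball; apply: card_tet; lia.
have cn : c < n by lia.
have [Eac|nE] := boolP (E a c.-2); last first.
  have [|v va ->] := staircase_skip_first _ ctop nE; first by lia.
  apply: stack_facet; first by apply: IH; lia.
    by apply: boundary_last; lia.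
  by apply/negP => /(staircase_cover cn); rewrite va ltnn.
have [|v [z [vE zE ->]]] := staircase_push_last _ ctop Eac; first by lia.
apply: push_vertex; first by apply: IH; lia.
- by apply: boundary_last; lia.
- by rewrite !inE vE eqxx !orbT.
by apply/negP => /staircase_cover; rewrite zE; lia.
Qed.

End Realization.

End StaircaseBall.

(** * Squeezed balls of degree at most two *)

Section Monomials.
Variable m : nat.
Implicit Types (u v : 'X_{1..m}) (i j : 'I_m).

Lemma mon_indices_sorted u : sorted leq (mon_indices u).
Proof.
rewrite /mon_indices; have : pairwise ltn (map val (enum 'I_m)).
  by rewrite -sorted_pairwise ?val_enum_ord ?iota_ltn_sorted //; apply: ltn_trans.
rewrite sorted_pairwise; last exact: leq_trans.
elim: (enum 'I_m) => //= i s IH /andP[/allP i_lt /IH s_sorted].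
rewrite pairwise_cat s_sorted andbT; apply/andP; split; last first.
  by elim: (u i) => //= k ->; rewrite andbT; apply/allP => x /nseqP[->].
apply/allrelP => x y /nseqP[-> _] /flattenP[_ /mapP[j js ->]] /nseqP[-> _].
by rewrite ltnS; apply/ltnW/i_lt/map_f.
Qed.

Lemma mon_indicesD u v :
  perm_eq (mon_indices (u + v)%MM) (mon_indices u ++ mon_indices v).
Proof.
rewrite /mon_indices; elim: (enum 'I_m) => //= i s IH.
rewrite mnmDE nseqD -!catA perm_cat2l.
by rewrite perm_sym perm_catCA perm_cat2l perm_sym.
Qed.

Lemma mon_indices_var i : mon_indices U_(i)%MM = [:: i.+1].
Proof.
rewrite /mon_indices; have : i \in enum 'I_m by rewrite mem_enum.
have := enum_uniq 'I_m.
have nil_flatten s : i \notin s ->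
    flatten [seq nseq (U_(i)%MM j) j.+1 | j <- s] = [::].
  elim: s => //= j s IH; rewrite inE negb_or => /andP[ij /IH->].
  by rewrite mnm1E (negbTE ij).
elim: (enum 'I_m) => //= j s IH /andP[js us]; rewrite inE mnm1E.
case: eqVneq => [ij _|ij /=]; last exact: IH.
by rewrite /= nil_flatten ?ij.
Qed.

Lemma mon_indices_pair i j : i <= j ->
  mon_indices (U_(i) + U_(j))%MM = [:: i.+1; j.+1].
Proof.
move=> ij; apply: (sorted_eq leq_trans anti_leq) (mon_indices_sorted _) _ _.
  by rewrite /= ltnS ij.
by rewrite (permPl (mon_indicesD _ _)) !mon_indices_var.
Qed.

Variant mon_le2_spec : 'X_{1..m} -> Prop :=
| MonOne : mon_le2_spec 0%MM
| MonVar i : mon_le2_spec U_(i)%MM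
| MonPair i j of i <= j : mon_le2_spec (U_(i) + U_(j))%MM.

Lemma mon_le2P u : mdeg u <= 2 -> mon_le2_spec u.
Proof.
have ex_var v : v != 0%MM -> exists i w, v = (U_(i) + w)%MM.
  move=> v0; have [i vi] : exists i, v i != 0.
    apply: contrapT => all0; case/eqP: v0; apply/mnmP => i; rewrite mnm0E.
    by apply: contrapT => /eqP vi; apply: all0; exists i.
  exists i, (v - U_(i))%MM; rewrite addmC submK //; apply/mnm_lepP => j.
  by rewrite mnm1E; case: eqVneq => [<-|//]; rewrite lt0n.
have [->|/ex_var[i [v ->]]] := eqVneq u 0%MM; first by constructor.
have [->|/ex_var[j [w ->]]] := eqVneq v 0%MM; first by rewrite addm0; constructor.
rewrite !mdegD !mdeg1 => w0; have -> : w = 0%MM.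
  by apply/eqP; rewrite -mdeg_eq0; lia.
rewrite addm0; have [ij|/ltnW ji] := leqP i j; first by constructor.
by rewrite addmC; constructor.
Qed.

End Monomials.

Lemma exists_ord_has k (P : pred nat) : [exists i : 'I_k, P i] = has P (iota 0 k).
Proof.
apply/existsP/hasP => [[i Pi]|[i]].
  by exists (i : nat); rewrite // mem_iota /= ltn_ord.
by rewrite mem_iota => /= ik Pi; exists (Ordinal ik).
Qed.

Section SqueezedBall.
Variables (n : nat) (n_gt5 : 5 < n).
Implicit Types (i j : 'I_(n - 6)) (u : 'X_{1..n - 6}).

Lemma last_lt : n.-1 < n. Proof. by lia. Qed.
Lemma penultimate_lt : n.-2 < n. Proof. by lia. Qed.

Let a : 'I_n := Ordinal penultimate_lt.
Let b : 'I_n := Ordinal last_lt.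

Lemma squeezed_facetE u :
  squeezed_facet n 5 u = [set v : 'I_n |
    has (fun p => (v.+1 == nth 0 (mon_indices u) p + 2 * p) ||
                  (v.+1 == nth 0 (mon_indices u) p + 2 * p + 1))
        (iota 0 (mdeg u)) || (n + 2 * mdeg u - 5 <= v.+1)].
Proof.
apply/setP => v; rewrite !inE.
by rewrite -(exists_ord_has (mdeg u) (fun p => (v.+1 == nth 0 (mon_indices u) p + 2 * p) ||
                  (v.+1 == nth 0 (mon_indices u) p + 2 * p + 1))).
Qed.

Lemma squeezed_facet_one :
  squeezed_facet n 5 (0%MM : 'X_{1..n - 6}) = a |: (b |: tet n (n - 6) (n - 4)).
Proof.
rewrite squeezed_facetE mdeg0; apply/setP => v.
by have := ltn_ord v; rewrite !inE -!val_eqE /=; lia.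
Qed.

Lemma squeezed_facet_var i :
  squeezed_facet n 5 U_(i)%MM = a |: (b |: tet n i (n - 4)).
Proof.
rewrite squeezed_facetE mdeg1 mon_indices_var; apply/setP => v.
by have := ltn_ord i; have := ltn_ord v; rewrite !inE -!val_eqE /=; lia.
Qed.

Lemma squeezed_facet_pair i j : i <= j ->
  squeezed_facet n 5 (U_(i) + U_(j))%MM = a |: (b |: tet n i j.+2).
Proof.
move=> ij; rewrite squeezed_facetE mdegD !mdeg1 mon_indices_pair //.
apply/setP => v; have := ltn_ord j.
by have := ltn_ord v; rewrite !inE -!val_eqE /=; lia.
Qed.

Variable U : classical_sets.set 'X_{1..n - 6}.
Hypotheses (hU : shifted_order_ideal U) (hdeg : degree_at_most U 2).

(** The facet {i, i+1, k, k+1} comes from x_(i+1) x_(k-1), the labels being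
    counted from 0. *)
Definition quadratic (i k : nat) : bool :=
  `[< exists i' j' : 'I_(n - 6), [/\ i = i', k = j'.+2, i' <= j' &
        U (U_(i') + U_(j'))%MM] >].

Lemma quadratic_up (i k i' k' : nat) : quadratic i k -> i <= i' -> k <= k' ->
  i'.+2 <= k' -> k'.+2 <= n - 3 -> quadratic i' k'.
Proof.
move=> /asboolP[p [q [-> -> pq Upq]]] pi' qk' ik' k'n.
have i'm : i' < n - 6 by lia.
have k'm : k' - 2 < n - 6 by lia.
apply/asboolP; exists (Ordinal i'm), (Ordinal k'm); split=> //=; try lia.
have [_ _ shifted] := hU; apply: (shifted _ _ Upq); split.
  by rewrite !mdegD !mdeg1.
rewrite mdegD !mdeg1 !mon_indices_pair //=; last by lia.
by case=> [|[|x]] //=; lia.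
Qed.

(** The facets of the monomials of degree 0 and 1 are those with [k = n - 4],
    the last possible value: [i = n - 6] for the monomial 1. *)
Lemma squeezed_ballE : squeezed_ball n 5 U =
  generated_complex [set` edge_join (staircase n quadratic 0 (n - 3)) a b]%classic.
Proof.
have tn : n - 3 < n by lia.
have [[U1 UX] _ _] := hU.
congr generated_complex; apply/seteqP; split=> [_ [u Uu <-]|F] /=.
  have u2 := hdeg Uu; case: (mon_le2P u2) Uu => [|i|i j ij] Uu.
  - rewrite squeezed_facet_one; apply: imset_f.
    by apply/staircaseP => //; constructor; lia.
  - rewrite squeezed_facet_var; apply: imset_f; have := ltn_ord i => im.
    by apply/staircaseP => //; constructor; lia.
  - rewrite squeezed_facet_pair //; apply: imset_f; have := ltn_ord j => jm.
    apply/staircaseP => //; constructor; try lia.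
    by apply/orP; left; apply/asboolP; exists i, j.
case/imsetP => _ /(staircaseP _ _ _ tn)[i k _ ik kn Qik] ->.
case/orP: Qik => [/asboolP[i' [j' [-> -> ij Uij]]]|/eqP kE].
  by exists (U_(i') + U_(j'))%MM => //; apply: squeezed_facet_pair.
have {kE} -> : k = n - 4 by lia.
have [im|im] := ltnP i (n - 6).
  by exists U_(Ordinal im)%MM; [apply: UX | apply: squeezed_facet_var].
have -> : i = n - 6 by lia.
by exists 0%MM => //; apply: squeezed_facet_one.
Qed.

End SqueezedBall.

Theorem lemma6p1 (R : realType) (n : nat) (hn : 5 < n)
    (U : set 'X_{1..n - 6})
    (hU : shifted_order_ideal U) (hdeg : degree_at_most U 2) :
  polytopal R 5 (squeezed_sphere n 5 U).
Proof.
have tn : n - 3 < n by lia.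
rewrite /squeezed_sphere (squeezed_ballE hn hU hdeg).
apply: edge_join_polytopal.
- by rewrite -val_eqE /=; lia.
- by apply/negP => /(staircase_cover tn) /=; lia.
- by apply/negP => /(staircase_cover tn) /=; lia.
- by apply: (staircase_convex_ball R tn (quadratic_up hn hU)); lia.
apply/set0Pn; exists (tri n 0 (n - 3).-1 (n - 3)).
by apply: boundary_last => //; lia.
Qed.
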